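(* $\tau$-Hochschild cohomology and homology are Morita invariant: if $\Lambda$ and $\Lambda'$ are Morita equivalent algebras, then for all $n\geq 1$ there are isomorphisms of vector spaces $\mathsf{HH}^n_\tau(\Lambda,\Lambda)\cong \mathsf{HH}^n_\tau(\Lambda',\Lambda')$ and $\mathsf{HH}_n^\tau(\Lambda,\Lambda)\cong \mathsf{HH}_n^\tau(\Lambda',\Lambda')$.
   Context: Let $k$ be a field. ''Algebra'' means a finite dimensional associative $k$-algebra $\Lambda$ with Jacobson radical $r$ such that $\Lambda/r$ is separable over $k$; Morita equivalence is $k$-linear. All modules and bimodules are finite dimensional over $k$; $D=\mathrm{Hom}_k(-,k)$; $\otimes=\otimes_k$. $\Lambda$-bimodules are left $\Lambda\otimes\Lambda^{\mathrm{op}}$-modules, and $\mathrm{Hom}_{\Lambda-\Lambda}$ denotes bimodule morphisms. $\tau$-Hochschild (co)homology: $\Omega^{m}$ is the $m$-th syzygy of bimodules taken with minimal projective resolutions ($\Omega^0=\mathrm{id}$); $\mathrm{Tr}M$ is the transpose, i.e. the cokernel of $\mathrm{Hom}(P_0,\Lambda\otimes\Lambda^{\mathrm{op}})\to\mathrm{Hom}(P_1,\Lambda\otimes\Lambda^{\mathrm{op}})$ for a minimal projective presentation $P_1\to P_0\to M\to 0$; $\tau=D\,\mathrm{Tr}$ is the Auslander–Reiten translate for $\Lambda$-bimodules; $\tau_n=\tau\Omega^{n-1}$ for $n\ge1$. For a $\Lambda$-bimodule $X$ and $n\geq 1$: $\mathsf{HH}^n_\tau(\Lambda,X)=D\,\mathrm{Hom}_{\Lambda-\Lambda}(X,\tau_n\Lambda)$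 and $\mathsf{HH}_n^\tau(\Lambda,X)=\mathrm{Hom}_{\Lambda-\Lambda}(DX,\tau_n\Lambda)$. *)

(* Defs.v *)
From HB Require Import structures.
From mathcomp Require Import all_boot all_algebra falgebra.
From mathcomp Require Import boolp.

Set Implicit Arguments.
Unset Strict Implicit.
Unset Printing Implicit Defensive.

Import GRing.Theory.
Local Open Scope ring_scope.

Definition intertwine (k : fieldType) (V W : vectType k)
  (g : 'End(V)) (h : 'End(W)) (f : 'Hom(V, W)) : 'Hom(V, W) :=
  (f \o g)%VF - (h \o f)%VF.

Lemma intertwine_is_linear (k : fieldType) (V W : vectType k)
  (g : 'End(V)) (h : 'End(W)) : linear (@intertwine k V W g h).
Proof.
move=> c f1 f2; apply/lfunP => x; rewrite /intertwine.
rewrite !(add_lfunE, opp_lfunE, scale_lfunE, comp_lfunE).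
by rewrite linearP scalerBr opprD addrACA.
Qed.

HB.instance Definition _ (k : fieldType) (V W : vectType k) g h :=
  GRing.isSemilinear.Build k 'Hom(V, W) 'Hom(V, W) _ (@intertwine k V W g h)
    (GRing.semilinear_linear (@intertwine_is_linear k V W g h)).

Section ConverseAlgebra.

Variables (k : fieldType) (A : falgType k).

HB.instance Definition _ := Vector.copy A^c A.

Lemma converse_scalerAl (c : k) (x y : A^c) : c *: (x * y) = (c *: x : A^c) * y.
Proof. exact: (@scalerAr k A c y x). Qed.

HB.instance Definition _ :=
  GRing.LSemiModule_isLSemiAlgebra.Build k A^c converse_scalerAl.

Lemma converse_scalerAr (c : k) (x y : A^c) : c *: (x * y) = x * (c *: y : A^c).
Proof. exact: (@scalerAl k A c y x). Qed.

HB.instance Definition _ :=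
  GRing.LSemiAlgebra_isSemiAlgebra.Build k A^c converse_scalerAr.

End ConverseAlgebra.
HB.instance Definition _ (k : fieldType) (A : falgType k) := GRing.UnitRing.on A^c.

(* The tensor product A (x) B of algebras: in the chosen bases (a_i) of A and
   (b_j) of B, the matrix t stands for \sum_(i, j) t i j *: (a_i (x) b_j). *)
Definition tensor (k : fieldType) (A B : falgType k) : Type :=
  'M[k]_(\dim {:A}, \dim {:B}).

Section Tensor.

Variables (k : fieldType) (A B : falgType k).
Local Notation tensorAB := (tensor A B).

HB.instance Definition _ := Vector.copy tensorAB 'M[k]_(\dim {:A}, \dim {:B}).

Definition pure (a : A) (b : B) : tensorAB :=
  \matrix_(i, j) (coord (vbasis {:A}) i a * coord (vbasis {:B}) j b).

(* The linear map on A (x) B induced by a bilinear map. *)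
Definition tensor_lift (V : lmodType k) (f : A -> B -> V) (t : tensorAB) : V :=
  \sum_i \sum_j (t : 'M_(_, _)) i j *: f (vbasis {:A})`_i (vbasis {:B})`_j.

Lemma tensor_lift_is_linear (V : lmodType k) (f : A -> B -> V) :
  linear (tensor_lift f).
Proof.
move=> c t u; rewrite /tensor_lift scaler_sumr -big_split /=.
apply: eq_bigr => i _; rewrite scaler_sumr -big_split /=.
by apply: eq_bigr => j _; rewrite !mxE scalerDl scalerA.
Qed.

HB.instance Definition _ (V : lmodType k) (f : A -> B -> V) :=
  GRing.isSemilinear.Build k tensorAB V _ (tensor_lift f)
    (GRing.semilinear_linear (tensor_lift_is_linear f)).

Definition bilin (V : lmodType k) (f : A -> B -> V) : Prop :=
  (forall a, linear (f a)) /\ (forall b, linear (f^~ b)).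

Lemma bilin_suml (V : lmodType k) (f : A -> B -> V) (n : nat)
  (c : 'I_n -> k) (x : 'I_n -> A) b : bilin f ->
  f (\sum_i c i *: x i) b = \sum_i c i *: f (x i) b.
Proof.
case=> _ /(_ b) fl; pose g : {linear A -> V} :=
  HB.pack (f^~ b) (GRing.isSemilinear.Build k A V _ (f^~ b)
    (GRing.semilinear_linear fl)).
rewrite -[LHS]/(g _) linear_sum; apply: eq_bigr => i _; exact: linearZ.
Qed.

Lemma bilin_sumr (V : lmodType k) (f : A -> B -> V) (n : nat)
  (c : 'I_n -> k) (x : 'I_n -> B) a : bilin f ->
  f a (\sum_i c i *: x i) = \sum_i c i *: f a (x i).
Proof.
case=> /(_ a) fl _; pose g : {linear B -> V} :=
  HB.pack (f a) (GRing.isSemilinear.Build k B V _ (f a)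
    (GRing.semilinear_linear fl)).
rewrite -[LHS]/(g _) linear_sum; apply: eq_bigr => i _; exact: linearZ.
Qed.

Lemma tensor_lift_pure (V : lmodType k) (f : A -> B -> V) a b :
  bilin f -> tensor_lift f (pure a b) = f a b.
Proof.
move=> fb; rewrite /tensor_lift.
rewrite {2}(coord_vbasis (memvf a)) {2}(coord_vbasis (memvf b)).
rewrite bilin_suml //; apply: eq_bigr => i _; rewrite bilin_sumr // scaler_sumr.
by apply: eq_bigr => j _; rewrite mxE scalerA.
Qed.

Lemma pure_bilin : bilin pure.
Proof.
split=> x c u v; apply/matrixP => i j; rewrite !mxE linearP /=.
  by rewrite mulrDr mulrCA.
by rewrite mulrDl mulrA.
Qed.

Lemma pure_vbasis (i : 'I_(\dim {:A})) (j : 'I_(\dim {:B})) :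
  pure (vbasis {:A})`_i (vbasis {:B})`_j = delta_mx i j.
Proof.
apply/matrixP => i' j'; rewrite !mxE.
by rewrite !coord_free ?(basis_free (vbasisP _)) // -natrM mulnb eq_sym [j == _]eq_sym.
Qed.

Lemma tensor_liftK (t : tensorAB) : tensor_lift pure t = t.
Proof.
rewrite [RHS]matrix_sum_delta; apply: eq_bigr => i _; apply: eq_bigr => j _.
by rewrite pure_vbasis.
Qed.

Lemma tensor_ext (V : lmodType k) (f g : tensorAB -> V) :
  linear f -> linear g -> (forall a b, f (pure a b) = g (pure a b)) -> f =1 g.
Proof.
move=> fl gl fg t; rewrite -(tensor_liftK t).
pose f' : {linear tensorAB -> V} := HB.pack f
  (GRing.isSemilinear.Build k tensorAB V _ f (GRing.semilinear_linear fl)).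
pose g' : {linear tensorAB -> V} := HB.pack g
  (GRing.isSemilinear.Build k tensorAB V _ g (GRing.semilinear_linear gl)).
rewrite -[f _]/(f' _) -[g _]/(g' _) /tensor_lift !linear_sum.
apply: eq_bigr => i _; rewrite !linear_sum; apply: eq_bigr => j _.
by rewrite !linearZ /= fg.
Qed.

(* (a (x) b) * (a' (x) b') = (a * a') (x) (b * b'); see tensor_mul_pure *)
Definition tensor_mul (x y : tensorAB) : tensorAB :=
  tensor_lift (fun a b => tensor_lift (fun a' b' => pure (a * a') (b * b')) y) x.

Definition tensor_one : tensorAB := pure 1 1.

Lemma pureM_bilinr a b : bilin (fun a' b' => pure (a * a') (b * b')).
Proof.
case: pure_bilin => pl pr.
by split=> x c u v /=; rewrite mulrDr -scalerAr ?pl ?pr.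
Qed.

Lemma tensor_mul_bilin (y : tensorAB) :
  bilin (fun a b => tensor_lift (fun a' b' => pure (a * a') (b * b')) y).
Proof.
case: pure_bilin => pl pr.
split=> x c u v /=; rewrite /tensor_lift scaler_sumr -big_split /=;
  apply: eq_bigr => i _; rewrite scaler_sumr -big_split /=;
  apply: eq_bigr => j _; rewrite mulrDl -scalerAl ?pl ?pr scalerDr !scalerA;
  by rewrite [c * _]mulrC.
Qed.

Lemma tensor_mul_pure a b a' b' :
  tensor_mul (pure a b) (pure a' b') = pure (a * a') (b * b').
Proof.
rewrite /tensor_mul tensor_lift_pure; last exact: tensor_mul_bilin.
by rewrite tensor_lift_pure //; exact: pureM_bilinr.
Qed.

Lemma tensor_mul_linearl (y : tensorAB) : linear (tensor_mul^~ y).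
Proof. by move=> c u v; rewrite /tensor_mul linearP. Qed.

Lemma tensor_mul_linearr (x : tensorAB) : linear (tensor_mul x).
Proof.
move=> c u v; rewrite /tensor_mul {1 3 5}/tensor_lift scaler_sumr -big_split /=.
apply: eq_bigr => i _; rewrite scaler_sumr -big_split /=.
by apply: eq_bigr => j _; rewrite linearP /= scalerDr !scalerA [c * _]mulrC.
Qed.

Lemma tensor_mulA : associative tensor_mul.
Proof.
move=> x y z; have ll := tensor_mul_linearl; have lr := tensor_mul_linearr.
apply: (@tensor_ext _ (fun x => tensor_mul x (tensor_mul y z))
  (fun x => tensor_mul (tensor_mul x y) z)) => [||a b].
- exact: ll.
- by move=> c u v; rewrite !ll.
apply: (@tensor_ext _ (fun y => tensor_mul _ (tensor_mul y z))
  (fun y => tensor_mul (tensor_mul _ y) z)) => [||a' b'].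
- by move=> c u v; rewrite ll lr.
- by move=> c u v; rewrite lr ll.
apply: (@tensor_ext _ (fun z => tensor_mul _ (tensor_mul _ z))
  (fun z => tensor_mul (tensor_mul _ _) z)) => [||a'' b''].
- by move=> c u v; rewrite !lr.
- exact: lr.
by rewrite !tensor_mul_pure !mulrA.
Qed.

Lemma tensor_mul1x : left_id tensor_one tensor_mul.
Proof.
apply: tensor_ext => [||a b]; [exact: tensor_mul_linearr | by [] |].
by rewrite tensor_mul_pure !mul1r.
Qed.

Lemma tensor_mulx1 : right_id tensor_one tensor_mul.
Proof.
apply: tensor_ext => [||a b]; [exact: tensor_mul_linearl | by [] |].
by rewrite tensor_mul_pure !mulr1.
Qed.

Lemma tensor_mulDl : left_distributive tensor_mul +%R.
Proof.
by move=> x y z; have := tensor_mul_linearl z 1 x y; rewrite !scale1r.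
Qed.

Lemma tensor_mulDr : right_distributive tensor_mul +%R.
Proof.
by move=> x y z; have := tensor_mul_linearr x 1 y z; rewrite !scale1r.
Qed.

Lemma tensor_one_neq0 : tensor_one != 0.
Proof.
have nz (C : falgType k) : exists i, coord (vbasis {:C}) i 1 != 0.
  apply/existsP; rewrite -negb_forall; apply/negP => /forallP z.
  have /eqP := oner_neq0 C; apply.
  rewrite (coord_vbasis (memvf 1)) big1 // => i _.
  by rewrite (eqP (z i)) scale0r.
have [i hi] := nz A; have [j hj] := nz B.
apply/eqP => /matrixP/(_ i j) /eqP; rewrite !mxE mulf_eq0.
by rewrite (negPf hi) (negPf hj).
Qed.

HB.instance Definition _ := GRing.Zmodule_isNzRing.Build tensorAB
  tensor_mulA tensor_mul1x tensor_mulx1 tensor_mulDl tensor_mulDr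
  tensor_one_neq0.

Lemma tensor_scalerAl (c : k) (x y : tensorAB) : c *: (x * y) = (c *: x : tensorAB) * y.
Proof.
have := tensor_mul_linearl y c x 0; rewrite addr0 /= => e.
rewrite -[RHS]/(tensor_mul (c *: x) y) e.
by rewrite -[tensor_mul 0 y]/((0 : tensorAB) * y) mul0r addr0.
Qed.

HB.instance Definition _ :=
  GRing.LSemiModule_isLSemiAlgebra.Build k tensorAB tensor_scalerAl.

Lemma tensor_scalerAr (c : k) (x y : tensorAB) : c *: (x * y) = x * (c *: y : tensorAB).
Proof.
have := tensor_mul_linearr x c y 0; rewrite addr0 /= => e.
rewrite -[RHS]/(tensor_mul x (c *: y)) e.
by rewrite -[tensor_mul x 0]/(x * (0 : tensorAB)) mulr0 addr0.
Qed.

HB.instance Definition _ :=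
  GRing.LSemiAlgebra_isSemiAlgebra.Build k tensorAB tensor_scalerAr.

HB.instance Definition _ := Algebra_isFalgebra.Build k tensorAB.

Lemma pureM a b a' b' : pure a b * pure a' b' = pure (a * a') (b * b').
Proof. exact: tensor_mul_pure. Qed.

End Tensor.


(* Finite dimensional left A-modules; right A-modules are left A^c-modules. *)
Record fdmod (k : fieldType) (A : falgType k) := FdMod {
  mcar :> vectType k;
  act : A -> mcar -> mcar;
  act_linearl : forall v, linear (act^~ v);
  act_linearr : forall a, linear (act a);
  act1 : forall v, act 1 v = v;
  actM : forall a b v, act (a * b) v = act a (act b v)
}.

Section Modules.

Variables (k : fieldType) (A : falgType k).
Implicit Types M N P Q : fdmod A.

HB.instance Definition _ M (a : A) :=
  GRing.isSemilinear.Build k M M _ (@act k A M a)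
    (GRing.semilinear_linear (@act_linearr k A M a)).

Definition actf M (a : A) : 'End(M) := linfun (@act k A M a).

Lemma actfE M a v : actf M a v = act a v. Proof. exact: lfunE. Qed.

Lemma act_suml M n (c : 'I_n -> k) (a : 'I_n -> A) (v : M) :
  act (\sum_i c i *: a i) v = \sum_i c i *: act (a i) v.
Proof.
pose g : {linear A -> M} := HB.pack ((@act k A M)^~ v)
  (GRing.isSemilinear.Build k A M _ ((@act k A M)^~ v)
    (GRing.semilinear_linear (@act_linearl k A M v))).
rewrite -[LHS]/(g _) linear_sum; apply: eq_bigr => i _; exact: linearZ.
Qed.

Lemma act0 M (v : M) : act 0 v = 0.
Proof. by have := @act_suml M 0 (fun=> 0) (fun=> 0) v; rewrite !big_ord0. Qed.

(* The space Hom_A(M, N) of A-linear maps; see mhomspP. *)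
Definition mhomsp M N : {vspace 'Hom(M, N)} :=
  (\bigcap_(i < \dim {:A})
     lker (linfun (intertwine (actf M (vbasis {:A})`_i)
                              (actf N (vbasis {:A})`_i))))%VS.

Lemma mhomspP M N (f : 'Hom(M, N)) :
  reflect (forall a v, f (act a v) = act a (f v)) (f \in mhomsp M N).
Proof.
apply: (iffP idP) => [fM a v | fM].
  rewrite (coord_vbasis (memvf a)) !act_suml linear_sum.
  apply: eq_bigr => i _; rewrite linearZ /=; congr (_ *: _).
  move: fM; rewrite memvE => /subv_bigcapP/(_ i isT).
  rewrite -memvE memv_ker lfunE /= /intertwine subr_eq0 => /eqP/lfunP/(_ v).
  by rewrite !comp_lfunE !actfE.
rewrite memvE; apply/subv_bigcapP => i _.
rewrite -memvE memv_ker lfunE /= /intertwine subr_eq0.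
by apply/eqP/lfunP => v; rewrite !comp_lfunE !actfE.
Qed.

Definition mhom M N : vectType k := subvs_of (mhomsp M N).

Definition mfun M N (f : mhom M N) : 'Hom(M, N) := vsval f.

Lemma mfun_act M N (f : mhom M N) a v : mfun f (act a v) = act a (mfun f v).
Proof. exact/(mhomspP (mfun f))/subvsP. Qed.

Lemma mfun_sum M N (f : mhom M N) n (x : 'I_n -> M) :
  mfun f (\sum_i x i) = \sum_i mfun f (x i).
Proof. exact: linear_sum. Qed.

Definition mkhom M N (f : 'Hom(M, N))
  (fM : forall a v, f (act a v) = act a (f v)) : mhom M N :=
  Subvs (introT (mhomspP f) fM).

Lemma mhom_ext M N (f g : mhom M N) : mfun f =1 mfun g -> f = g.
Proof. by move=> fg; apply: val_inj; apply/lfunP. Qed.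

Lemma mid_subproof M a (v : M) : (\1%VF : 'End(M)) (act a v) = act a (\1%VF v).
Proof. by rewrite !id_lfunE. Qed.

Definition mid M : mhom M M := mkhom (@mid_subproof M).

Lemma mcomp_subproof M N P (g : mhom N P) (f : mhom M N) a v :
  (mfun g \o mfun f)%VF (act a v) = act a ((mfun g \o mfun f)%VF v).
Proof. by rewrite !comp_lfunE !mfun_act. Qed.

Definition mcomp M N P (g : mhom N P) (f : mhom M N) : mhom M P :=
  mkhom (mcomp_subproof g f).

Lemma mcompE M N P (g : mhom N P) (f : mhom M N) v :
  mfun (mcomp g f) v = mfun g (mfun f v).
Proof. exact: comp_lfunE. Qed.

Definition miso M N (f : mhom M N) : Prop :=
  exists g : mhom N M, mcomp g f = mid M /\ mcomp f g = mid N.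

Definition msurj M N (f : mhom M N) : Prop := forall y, exists x, mfun f x = y.

Definition stable M (U : {vspace M}) : Prop :=
  forall a u, u \in U -> act a u \in U.

Section Submodule.

Variables (M : fdmod A) (U : {vspace M}) (sU : stable U).

Definition sub_act (a : A) (u : subvs_of U) : subvs_of U :=
  vsproj U (act a (vsval u)).

Lemma sub_actE a u : vsval (sub_act a u) = act a (vsval u).
Proof. by rewrite vsprojK // sU // subvsP. Qed.

Lemma sub_act_linearl u : linear (sub_act^~ u).
Proof. by move=> c a b; rewrite /sub_act act_linearl linearP. Qed.

Lemma sub_act_linearr a : linear (sub_act a).
Proof. by move=> c u v; rewrite /sub_act !linearP. Qed.

Lemma sub_act1 u : sub_act 1 u = u.
Proof. by apply: val_inj; rewrite /= sub_actE act1. Qed.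

Lemma sub_actM a b u : sub_act (a * b) u = sub_act a (sub_act b u).
Proof. by apply: val_inj; rewrite /= !sub_actE actM. Qed.

Definition submod : fdmod A :=
  FdMod sub_act_linearl sub_act_linearr sub_act1 sub_actM.

Lemma subincl_subproof a (u : submod) :
  linfun (@vsval k M U) (act a u) = act a (linfun (@vsval k M U) u).
Proof. by rewrite !lfunE /= sub_actE. Qed.

Definition subincl : mhom submod M := mkhom subincl_subproof.

Lemma subinclE (u : submod) : mfun subincl u = vsval u.
Proof. exact: lfunE. Qed.

(* The quotient M / U lives on the complement of U, via the projection
   along U. *)
Definition quot_proj : 'Hom(M, subvs_of (U^C)) :=
  (linfun (vsproj (U^C)) \o daddv_pi (U^C) U)%VF.

Lemma quot_projE v : vsval (quot_proj v) = daddv_pi (U^C) U v.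
Proof. by rewrite comp_lfunE lfunE /= vsprojK // memv_pi. Qed.

Lemma quot_proj_sub v : v - vsval (quot_proj v) \in U.
Proof.
rewrite quot_projE.
have cap : (U^C :&: U = 0)%VS by rewrite capvC capv_compl.
have add : v \in (U^C + U)%VS by rewrite addvC addv_complf memvf.
by rewrite -{1}(daddv_pi_add cap add) addrAC subrr add0r memv_pi.
Qed.

Lemma quot_projK (w : subvs_of (U^C)) : quot_proj (vsval w) = w.
Proof.
apply: val_inj; rewrite /= quot_projE daddv_pi_id ?subvsP //.
by rewrite capvC capv_compl.
Qed.

Lemma quot_proj_eq0 v : (quot_proj v == 0) = (v \in U).
Proof.
apply/eqP/idP => [e | vU].
  have := quot_proj_sub v; rewrite e -[vsval 0]/(0 : M).
  by rewrite subr0.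
apply: val_inj; apply/eqP; rewrite -[val 0]/(0 : M) /=; rewrite -memv0 -(capv_compl U) memv_cap.
rewrite subvsP andbT -(opprK (vsval _)) memvN -[- _](addKr v) addrC.
by rewrite memvB ?quot_proj_sub // -opprB.
Qed.

Definition quot_act (a : A) (w : subvs_of (U^C)) : subvs_of (U^C) :=
  quot_proj (act a (vsval w)).

Lemma quot_proj_act a v : quot_proj (act a v) = quot_act a (quot_proj v).
Proof.
apply/eqP; rewrite -subr_eq0 -linearB quot_proj_eq0 /= -linearB sU //.
exact: quot_proj_sub.
Qed.

Lemma quot_act_linearl w : linear (quot_act^~ w).
Proof. by move=> c a b; rewrite /quot_act act_linearl linearP. Qed.

Lemma quot_act_linearr a : linear (quot_act a).
Proof. by move=> c u v; rewrite /quot_act !linearP. Qed.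

Lemma quot_act1 w : quot_act 1 w = w.
Proof. by rewrite /quot_act act1 quot_projK. Qed.

Lemma quot_actM a b w : quot_act (a * b) w = quot_act a (quot_act b w).
Proof. by rewrite {1}/quot_act actM quot_proj_act. Qed.

Definition quotmod : fdmod A :=
  FdMod quot_act_linearl quot_act_linearr quot_act1 quot_actM.

End Submodule.

Lemma mker_stable M N (f : mhom M N) : stable (lker (mfun f)).
Proof.
by move=> a u; rewrite !memv_ker mfun_act => /eqP->; rewrite linear0.
Qed.

Lemma mimg_stable M N (f : mhom M N) : stable (limg (mfun f)).
Proof.
move=> a _ /memv_imgP[u _ ->]; rewrite -mfun_act.
by apply: memv_img; exact: memvf.
Qed.

Arguments mker_stable {M N} f.
Arguments mimg_stable {M N} f.

Definition mker M N (f : mhom M N) : fdmod A := submod (mker_stable f).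
Definition mkerincl M N (f : mhom M N) : mhom (mker f) M :=
  subincl (mker_stable f).
Definition mcoker M N (f : mhom M N) : fdmod A := quotmod (mimg_stable f).

Lemma reg_linearl (x : A) : linear ( *%R^~ x).
Proof. by move=> c a b /=; rewrite mulrDl scalerAl. Qed.

Lemma reg_linearr (a : A) : linear ( *%R a).
Proof. by move=> c x y; rewrite mulrDr scalerAr. Qed.

Definition regmod : fdmod A :=
  FdMod reg_linearl reg_linearr (@mul1r A) (fun a b x => esym (mulrA a b x)).

Definition projective P : Prop :=
  forall M N (g : mhom M N) (h : mhom P N), msurj g ->
  exists l : mhom P M, mcomp g l = h.

(* p is a projective cover: an epimorphism from a projective module whose
   kernel is superfluous *)
Definition proj_cover P M (p : mhom P M) : Prop :=
  [/\ projective P, msurj p &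
      forall U : {vspace P}, stable U -> (U + lker (mfun p) = fullv)%VS ->
        U = fullv].

Section Free.

Variable n : nat.

Definition free_act (a : A) (x : {ffun 'I_n -> A}) : {ffun 'I_n -> A} :=
  [ffun i => a * x i].

Lemma free_act_linearl x : linear (free_act^~ x).
Proof.
by move=> c a b; apply/ffunP => i; rewrite !ffunE mulrDl scalerAl.
Qed.

Lemma free_act_linearr a : linear (free_act a).
Proof.
by move=> c x y; apply/ffunP => i; rewrite !ffunE mulrDr scalerAr.
Qed.

Lemma free_act1 x : free_act 1 x = x.
Proof. by apply/ffunP => i; rewrite !ffunE mul1r. Qed.

Lemma free_actM a b x : free_act (a * b) x = free_act a (free_act b x).
Proof. by apply/ffunP => i; rewrite !ffunE mulrA. Qed.

Definition freemod : fdmod A :=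
  FdMod free_act_linearl free_act_linearr free_act1 free_actM.

Variables (M : fdmod A) (m : 'I_n -> M).

Definition free_map_fun (x : {ffun 'I_n -> A}) : M := \sum_i act (x i) (m i).

Lemma free_map_linear : linear free_map_fun.
Proof.
move=> c x y; rewrite /free_map_fun scaler_sumr -big_split /=.
by apply: eq_bigr => i _; rewrite !ffunE act_linearl.
Qed.

HB.instance Definition _ := GRing.isSemilinear.Build k {ffun 'I_n -> A} M _
  free_map_fun (GRing.semilinear_linear free_map_linear).

Definition free_map_lfun : 'Hom(freemod, M) := linfun free_map_fun.

Lemma free_map_subproof a (x : freemod) :
  free_map_lfun (act a x) = act a (free_map_lfun x).
Proof.
rewrite !lfunE /= /free_map_fun linear_sum /=.
by apply: eq_bigr => i _; rewrite ffunE actM.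
Qed.

Definition free_map : mhom freemod M := mkhom free_map_subproof.

Lemma free_mapE (x : freemod) :
  mfun free_map x = \sum_i act ((x : {ffun _ -> _}) i) (m i).
Proof. exact: lfunE. Qed.

Definition free_gen (i : 'I_n) : freemod := [ffun j => (i == j)%:R].

Lemma free_expand (x : freemod) :
  x = \sum_i act ((x : {ffun _ -> _}) i) (free_gen i).
Proof.
apply/ffunP => j; rewrite sum_ffunE (bigD1 j) //= !ffunE eqxx mulr1.
by rewrite big1 ?addr0 // => i /negPf ij; rewrite !ffunE ij mulr0.
Qed.

End Free.

Lemma free_map_gen n M (m : 'I_n -> M) i : mfun (free_map m) (free_gen i) = m i.
Proof.
rewrite free_mapE (bigD1 i) //= !ffunE eqxx act1 big1 ?addr0 // => j ji.
by rewrite !ffunE eq_sym (negPf ji) act0.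
Qed.

Lemma freemod_projective n : projective (freemod n).
Proof.
move=> M N g h gs.
have [s hs] := @choice _ _ (fun (i : 'I_n) (x : M) => mfun g x = mfun h (free_gen i))
  (fun i => gs _).
exists (free_map s); apply: mhom_ext => x; rewrite mcompE.
rewrite (free_expand x) !mfun_sum; apply: eq_bigr => i _.
by rewrite !mfun_act free_map_gen hs.
Qed.

Lemma proj_cover_exists M : exists P : fdmod A, exists p : mhom P M, proj_cover p.
Proof.
pose n := \dim {:M}; pose F := freemod n.
pose p : mhom F M := free_map (fun i => (vbasis {:M})`_i).
have ps : limg (mfun p) = fullv.
  apply/vspaceP => x; rewrite memvf (coord_vbasis (memvf x)).
  apply: memv_suml => i _; apply: memvZ.
  have <- : mfun p (free_gen i) = (vbasis {:M})`_i by exact: free_map_gen.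
  by apply: memv_img; exact: memvf.
pose good d := `[< exists U : {vspace F},
  [/\ stable U, (mfun p @: U)%VS = fullv & \dim U = d] >].
have exg : exists d, good d.
  by exists (\dim {:F}); apply/asboolP; exists fullv; split=> // a u _; apply: memvf.
case: (ex_minnP exg) => d /asboolP[U [sU pU dU]] dmin.
have Umin (W : {vspace F}) :
    stable W -> (mfun p @: W)%VS = fullv -> (W <= U)%VS -> W = U.
  move=> sW pW WU; apply/eqP; rewrite eqEdim WU dU; apply: dmin.
  by apply/asboolP; exists W.
pose i := subincl sU; pose q := mcomp p i.
have qs : msurj q.
  move=> y; have: y \in (mfun p @: U)%VS by rewrite pU memvf.
  case/memv_imgP => x xU ->; exists (vsproj U x).
  by rewrite mcompE subinclE vsprojK.
have [g gE] : exists g : mhom F (submod sU), mcomp q g = p.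
  exact: freemod_projective.
pose h := mcomp g i : mhom (submod sU) (submod sU).
have qh x : mfun q (mfun h x) = mfun q x.
  by rewrite [mfun h x]mcompE -mcompE gE [RHS]mcompE.
have img_full (W : {vspace submod sU}) :
    stable W -> (mfun q @: W)%VS = fullv -> W = fullv.
  move=> sW qW; have : (mfun i @: W)%VS = U.
    apply: Umin.
    - move=> a _ /memv_imgP[w wW ->]; rewrite -mfun_act.
      by apply: memv_img; apply: sW.
    - by rewrite -limg_comp.
    - by apply/subvP => _ /memv_imgP[w _ ->]; rewrite subinclE subvsP.
  move=> iW; apply/eqP; rewrite eqEdim subvf /=.
  have -> : \dim {: submod sU} = \dim U by rewrite dimvf.
  have <- : \dim (mfun i @: W)%VS = \dim U by rewrite iW.
  by rewrite -(limg_ker_dim (mfun i) W) leq_addl.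
have hker0 : lker (mfun h) == 0%VS.
  have hf : limg (mfun h) = fullv.
    apply: img_full; first exact: mimg_stable.
    apply/vspaceP => y; rewrite memvf; have [x <-] := qs y.
    by rewrite -qh !memv_img ?memvf.
  rewrite -dimv_eq0; have := limg_ker_dim (mfun h) fullv.
  by rewrite hf capfv => /eqP; rewrite -{2}[\dim fullv]add0n eqn_add2r.
pose hi := (mfun h)^-1%VF.
have hK x : hi (mfun h x) = x by exact: lker0_lfunK.
have Kh x : mfun h (hi x) = x by exact: lker0_lfunVK.
have hiM a x : hi (act a x) = act a (hi x).
  by rewrite -{1}(Kh x) -mfun_act hK.
pose r := mcomp (mkhom hiM) g.
have ri : mcomp r i = mid _.
  apply: mhom_ext => x; rewrite !mcompE /mfun /= -/(mfun _).
  by rewrite id_lfunE -[LHS]/(hi (mfun g (mfun i x))) -mcompE hK.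
exists (submod sU), q; split=> //.
- move=> N N' a b sa; have [l lE] := freemod_projective (mcomp b r) sa.
  exists (mcomp l i); apply: mhom_ext => x.
  rewrite !mcompE -mcompE lE !mcompE; congr (mfun b _).
  by rewrite -!mcompE -/r ri /mfun /= id_lfunE.
- move=> W sW Wf; apply: img_full => //.
  apply/vspaceP => y; rewrite memvf; have [x <-] := qs y.
  have : x \in (W + lker (mfun q))%VS by rewrite Wf memvf.
  case/memv_addP => w wW [z]; rewrite memv_ker => /eqP zq ->.
  by rewrite linearD /= zq addr0 memv_img.
Qed.

(* A chosen projective cover: unique up to isomorphism. *)
Definition pcover M : fdmod A := projT1 (cid (proj_cover_exists M)).
Definition pcover_map M : mhom (pcover M) M :=
  projT1 (cid (projT2 (cid (proj_cover_exists M)))).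

Lemma pcoverP M : proj_cover (pcover_map M).
Proof. exact: projT2 (cid (projT2 (cid (proj_cover_exists M)))). Qed.

Definition syzygy M : fdmod A := mker (pcover_map M).

(* The map P1 -> P0 of the minimal projective presentation of M, where
   P0 = pcover M and P1 = pcover (syzygy M) *)
Definition presentation M : mhom (pcover (syzygy M)) (pcover M) :=
  mcomp (mkerincl (pcover_map M)) (pcover_map (syzygy M)).

Section HomReg.

(* Hom_A(M, A) as a right A-module: (f b)(x) = f(x) * b. *)
Variable M : fdmod A.

Definition homreg_fun (b : A^c) (f : mhom M regmod) : 'Hom(M, regmod) :=
  (amulr (b : A) \o mfun f)%VF.

Lemma homreg_funE b f v : homreg_fun b f v = (mfun f v : A) * (b : A).
Proof. by rewrite [LHS]comp_lfunE lfunE. Qed.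

Lemma homreg_subproof b f a v :
  homreg_fun b f (act a v) = act a (homreg_fun b f v).
Proof. by rewrite !homreg_funE mfun_act /= mulrA. Qed.

Definition homreg_act (b : A^c) (f : mhom M regmod) : mhom M regmod :=
  mkhom (homreg_subproof b f).

Lemma homreg_actE b f v : mfun (homreg_act b f) v = (mfun f v : A) * (b : A).
Proof. exact: homreg_funE. Qed.

Lemma mfun_lin P Q c (f g : mhom P Q) v :
  mfun (c *: f + g) v = c *: mfun f v + mfun g v.
Proof. by rewrite /mfun linearP /= add_lfunE scale_lfunE. Qed.

Lemma homreg_linearl f : linear (homreg_act^~ f).
Proof.
move=> c a b; apply: mhom_ext => v; rewrite mfun_lin !homreg_actE.
by rewrite mulrDr -scalerAr.
Qed.

Lemma homreg_linearr b : linear (homreg_act b).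
Proof.
move=> c f g; apply: mhom_ext => v; rewrite mfun_lin !homreg_actE mfun_lin.
by rewrite mulrDl -scalerAl.
Qed.

Lemma homreg_act1 f : homreg_act 1 f = f.
Proof. by apply: mhom_ext => v; rewrite homreg_actE mulr1. Qed.

Lemma homreg_actM a b f :
  homreg_act (a * b) f = homreg_act a (homreg_act b f).
Proof. by apply: mhom_ext => v; rewrite !homreg_actE mulrA. Qed.

Definition homreg : fdmod A^c :=
  FdMod homreg_linearl homreg_linearr homreg_act1 homreg_actM.

End HomReg.

End Modules.

Section HomRegMap.

Variables (k : fieldType) (A : falgType k) (M N : fdmod A) (g : mhom M N).

Definition precomp (f : homreg N) : homreg M := mcomp (f : mhom N _) g.

Lemma precomp_linear : linear precomp.
Proof.
by move=> c f f'; apply: mhom_ext => v; rewrite mfun_lin !mcompE mfun_lin.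
Qed.

HB.instance Definition _ := GRing.isSemilinear.Build k (homreg N) (homreg M) _
  precomp (GRing.semilinear_linear precomp_linear).

Lemma precomp_act b f : linfun precomp (act b f) = act b (linfun precomp f).
Proof.
by rewrite !lfunE; apply: mhom_ext => v; rewrite mcompE !homreg_actE mcompE.
Qed.

(* Hom_A(g, A) : f |-> f o g *)
Definition homreg_map : mhom (homreg N) (homreg M) := mkhom precomp_act.

Lemma homreg_mapE f v : mfun (mfun homreg_map f : mhom M _) v = mfun f (mfun g v).
Proof. by rewrite [mfun homreg_map f]lfunE mcompE. Qed.

End HomRegMap.

Definition transpose (k : fieldType) (A : falgType k) (M : fdmod A) : fdmod A^c :=
  mcoker (homreg_map (presentation M)).

Section Dual.

(* D M = Hom_k(M, k), made a B-module through an anti-morphism s : B -> A: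
   (b phi)(x) = phi (s b x). *)
Variables (k : fieldType) (A B : falgType k) (s : {linear B -> A}).
Hypotheses (s1 : s 1 = 1) (sM : forall x y, s (x * y) = s y * s x).
Variable M : fdmod A.

Definition dual_act (b : B) (phi : 'Hom(M, k^o)) : 'Hom(M, k^o) :=
  (phi \o actf M (s b))%VF.

Lemma dual_actE b phi v : dual_act b phi v = phi (act (s b) v).
Proof. by rewrite comp_lfunE actfE. Qed.

Lemma dual_act_linearl phi : linear (dual_act^~ phi).
Proof.
move=> c a b; apply/lfunP => v; rewrite add_lfunE scale_lfunE !dual_actE.
by rewrite linearP act_linearl linearP.
Qed.

Lemma dual_act_linearr b : linear (dual_act b).
Proof.
move=> c f g; apply/lfunP => v; rewrite add_lfunE scale_lfunE !dual_actE.
by rewrite add_lfunE scale_lfunE.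
Qed.

Lemma dual_act1 phi : dual_act 1 phi = phi.
Proof. by apply/lfunP => v; rewrite dual_actE s1 act1. Qed.

Lemma dual_actM a b phi : dual_act (a * b) phi = dual_act a (dual_act b phi).
Proof. by apply/lfunP => v; rewrite !dual_actE sM actM. Qed.

Definition dual_along : fdmod B :=
  FdMod dual_act_linearl dual_act_linearr dual_act1 dual_actM.

End Dual.

(* A -> A^c is anti-multiplicative, so that it turns the dual of a right
   A-module into a left A-module. *)
Definition to_converse (k : fieldType) (A : falgType k) (a : A) : A^c := a.

Lemma to_converse_is_linear (k : fieldType) (A : falgType k) :
  linear (@to_converse k A).
Proof. by []. Qed.

HB.instance Definition _ (k : fieldType) (A : falgType k) :=
  GRing.isSemilinear.Build k A A^c _ (@to_converse k A)
    (GRing.semilinear_linear (@to_converse_is_linear k A)).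

Lemma to_converse1 (k : fieldType) (A : falgType k) : @to_converse k A 1 = 1.
Proof. by []. Qed.

Lemma to_converseM (k : fieldType) (A : falgType k) (x y : A) :
  to_converse (x * y) = to_converse y * to_converse x.
Proof. by []. Qed.

Definition dual_right (k : fieldType) (A : falgType k) (M : fdmod A^c) : fdmod A :=
  dual_along (@to_converse1 k A) (@to_converseM k A) M.

Definition tau (k : fieldType) (A : falgType k) (M : fdmod A) : fdmod A :=
  dual_right (transpose M).

Definition tau_n (k : fieldType) (A : falgType k) (n : nat) (M : fdmod A) : fdmod A :=
  tau (iter n.-1 (@syzygy k A) M).

Section Bimodules.

Variables (k : fieldType) (A : falgType k).

Definition enveloping : falgType k := tensor A A^c.

Definition bimod : Type := fdmod enveloping.

(* The bimodule A: (a (x) b) x = a * x * b *)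
Definition regbim_act (t : enveloping) (x : A) : A :=
  tensor_lift (fun (a : A) (b : A^c) => a * x * (b : A)) t.

Lemma regbim_bilin (x : A) : bilin (fun (a : A) (b : A^c) => a * x * (b : A)).
Proof.
split=> y c u v /=; first by rewrite mulrDr -scalerAr.
by rewrite !mulrDl -!scalerAl.
Qed.

Lemma regbim_act_pure a (b : A^c) x : regbim_act (pure a b) x = a * x * (b : A).
Proof. by rewrite /regbim_act tensor_lift_pure //; exact: regbim_bilin. Qed.

Lemma regbim_linearl x : linear (regbim_act^~ x).
Proof. by move=> c t u; rewrite /regbim_act linearP. Qed.

Lemma regbim_linearr t : linear (regbim_act t).
Proof.
move=> c x y; rewrite /regbim_act /tensor_lift scaler_sumr -big_split /=.
apply: eq_bigr => i _; rewrite scaler_sumr -big_split /=.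
apply: eq_bigr => j _.
by rewrite mulrDr mulrDl -scalerAr -scalerAl scalerDr !scalerA [c * _]mulrC.
Qed.

Lemma regbim_act1 x : regbim_act 1 x = x.
Proof. by rewrite regbim_act_pure mul1r mulr1. Qed.

Lemma regbim_actM t u x : regbim_act (t * u) x = regbim_act t (regbim_act u x).
Proof.
have ll := regbim_linearl; have lr := regbim_linearr.
apply: (@tensor_ext _ _ _ _ (fun t => regbim_act (t * u) x)
  (fun t => regbim_act t (regbim_act u x))) => [||a b].
- by move=> c v w; rewrite mulrDl -scalerAl ll.
- exact: ll.
apply: (@tensor_ext _ _ _ _ (fun u => regbim_act (_ * u) x)
  (fun u => regbim_act _ (regbim_act u x))) => [||a' b'].
- by move=> c v w; rewrite mulrDr -scalerAr ll.
- by move=> c v w; rewrite ll lr.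
by rewrite pureM !regbim_act_pure !mulrA.
Qed.

Definition regbim : bimod :=
  @FdMod k enveloping A regbim_act regbim_linearl regbim_linearr
    regbim_act1 regbim_actM.

(* a (x) b |-> b (x) a *)
Definition swap : enveloping -> enveloping :=
  tensor_lift (fun (a : A) (b : A^c) => pure (b : A) (a : A^c)).

HB.instance Definition _ := GRing.Linear.on swap.

Lemma swap_bilin :
  bilin (fun (a : A) (b : A^c) => pure (b : A) (a : A^c)).
Proof. by case: (@pure_bilin k A A^c) => pl pr; split. Qed.

Lemma swap_pure (a : A) (b : A^c) : swap (pure a b) = pure (b : A) (a : A^c).
Proof. by rewrite /swap tensor_lift_pure //; exact: swap_bilin. Qed.

Lemma swap1 : swap 1 = 1.
Proof. exact: swap_pure. Qed.

Lemma swapM t u : swap (t * u) = swap u * swap t.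
Proof.
apply: (@tensor_ext _ _ _ _ (fun t => swap (t * u))
  (fun t => swap u * swap t)) => [||a b].
- by move=> c v w; rewrite mulrDl -scalerAl linearP.
- by move=> c v w; rewrite linearP mulrDr -scalerAr.
apply: (@tensor_ext _ _ _ _ (fun u => swap (_ * u))
  (fun u => swap u * swap _)) => [||a' b'].
- by move=> c v w; rewrite mulrDr -scalerAr linearP.
- by move=> c v w; rewrite linearP mulrDl -scalerAl.
by rewrite pureM !swap_pure pureM.
Qed.

(* The dual bimodule: (a phi b)(x) = phi (b x a) *)
Definition dualbim (X : bimod) : bimod := dual_along swap1 swapM X.

(* D Hom(X, tau_n A), resp. Hom(D X, tau_n A); meant for n >= 1 *)
Definition HHtau_cohomology (n : nat) (X : bimod) : vectType k :=
  'Hom(mhom X (tau_n n regbim), k^o).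

Definition HHtau_homology (n : nat) (X : bimod) : vectType k :=
  mhom (dualbim X) (tau_n n regbim).

(* B is separable when it is projective as a B-bimodule. *)
Definition separable_alg : Prop := projective regbim.

(* Left ideals of A are automatically k-subspaces. *)
Definition left_ideal (I : {vspace A}) : Prop :=
  forall a x, x \in I -> a * x \in I.

Definition maximal_left_ideal (I : {vspace A}) : Prop :=
  [/\ left_ideal I, I != fullv &
      forall J : {vspace A}, left_ideal J -> (I <= J)%VS -> J != fullv -> J = I].

(* The Jacobson radical: the intersection of all maximal left ideals. *)
Definition in_jacobson (x : A) : Prop :=
  forall I : {vspace A}, maximal_left_ideal I -> x \in I.

End Bimodules.

(* A / r is separable; the quotient is given by a surjective algebra morphism
   with kernel r. *)
Definition separable_mod_radical (k : fieldType) (A : falgType k) : Prop :=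
  exists (B : falgType k) (p : {lrmorphism A -> B}),
    [/\ forall y, exists x, p x = y,
        forall x, p x = 0 <-> in_jacobson x &
        separable_alg B].

Record kfunctor (k : fieldType) (A B : falgType k) := KFunctor {
  fobj :> fdmod A -> fdmod B;
  fmap : forall M N, {linear mhom M N -> mhom (fobj M) (fobj N)};
  fmap_id : forall M, fmap M M (mid M) = mid (fobj M);
  fmap_comp : forall M N P (g : mhom N P) (f : mhom M N),
    fmap M P (mcomp g f) = mcomp (fmap N P g) (fmap M N f)
}.

Definition natiso_id (k : fieldType) (A B : falgType k)
  (F : kfunctor A B) (G : kfunctor B A) : Prop :=
  exists eta : forall M : fdmod A, mhom M (G (F M)),
    (forall M, miso (eta M)) /\
    forall M N (f : mhom M N),
      mcomp (eta N) f = mcomp (fmap G _ _ (fmap F _ _ f)) (eta M).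

(* k-linear equivalence of the categories of finite dimensional modules *)
Definition Morita_equivalent (k : fieldType) (A B : falgType k) : Prop :=
  exists (F : kfunctor A B) (G : kfunctor B A), natiso_id F G /\ natiso_id G F.

Definition vsp_iso (k : fieldType) (U V : vectType k) : Prop :=
  exists f : {linear U -> V}, bijective f.

(* Main.v *)
Require Import Defs.
From HB Require Import structures.
From mathcomp Require Import all_boot all_algebra falgebra.
From mathcomp Require Import boolp.

Set Implicit Arguments.
Unset Strict Implicit.
Unset Printing Implicit Defensive.

Import GRing.Theory VectorInternalTheory.
Local Open Scope ring_scope.

(** Both spaces are built from Hom(X, tau_n L), with X = L or X = D L, so that
    only the dimension of Hom(X, tau_n L) has to be compared. Two facts reduce
    this to the existence of equivalences of bimodule categories.

    The dimension of Hom(X, tau M) is categorical. With P1 -> P0 -> M the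
    minimal projective presentation, Hom(X, tau M) is the dual of the cokernel
    of Hom(P0, X) -> Hom(P1, X), because Hom(X, D Hom(P, A)) = D Hom(P, X) for
    P projective; left exactness then gives (dim_hom_tau)
      dim Hom(X, tau M) + dim Hom(P0, X) = dim Hom(P1, X) + dim Hom(M, X).
    An equivalence of module categories preserves projective covers and
    kernels, hence syzygies and the dimension of Hom(X, tau_n M)
    (equiv_dim_hom_tau_n).

    Let F : mod L -> mod L' be an equivalence with quasi-inverse G. A bimodule
    is a module over one factor with an action of the other factor by
    endomorphisms, and a functor carries this action along. So F induces an
    equivalence from L-bimodules to L'-L-bimodules (lift_equivalence). The
    conjugate D G D of G by the duality is an equivalence of right modules
    (converse_equivalence), and induces one from L'-bimodules to
    L'-L-bimodules. The two are compared in the middle: it remains to see that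
      F(L) = D G (D L')   and   F(D L) = D G (D D L')
    as L'-L-bimodules. Both come from a single perfect pairing between F(D L)
    and G(L'): an element y of F(D L) is a map L' -> F(D L), which G turns
    into a map G(L') -> G F (D L) = D L, that is, a functional on G(L')
    (perfect_pairing). Used for (F, G) it gives the second isomorphism, and
    used for (G, F), read from the other side, the first. *)

(** * Linear maps and dimensions *)

(** Locked, so that rewriting with lin_mapE does not unfold composites and
    other maps that are themselves built with linfun. *)
HB.lock Definition lin_map (k : fieldType) (U V : vectType k) (f : U -> V)
    (fl : linear f) : 'Hom(U, V) :=
  linfun (HB.pack f (GRing.isSemilinear.Build k U V _ f
    (GRing.semilinear_linear fl)) : {linear U -> V}).

Lemma lin_mapE (k : fieldType) (U V : vectType k) (f : U -> V)
  (fl : linear f) v : lin_map fl v = f v.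
Proof. by rewrite lin_map.unlock lfunE. Qed.

Section LinearMaps.

Variable k : fieldType.
Implicit Types U V W : vectType k.

Lemma dim_hom U V : dim 'Hom(U, V) = (dim U * dim V)%N.
Proof. by []. Qed.

Lemma dim_dual U : dim 'Hom(U, k^o) = dim U.
Proof. by rewrite dim_hom -[RHS]muln1. Qed.

Lemma dim_subvs U (W : {vspace U}) : dim (subvs_of W) = \dim W.
Proof. by []. Qed.

Lemma dim_inj_surj U V (f : 'Hom(U, V)) :
  injective f -> (forall y, exists x, f x = y) -> dim U = dim V.
Proof.
move=> fi fs; rewrite -!dimvf -(limg_dim_eq (f := f) (U := fullv)).
  congr (\dim _); apply/vspaceP => y; rewrite memvf.
  by have [x <-] := fs y; rewrite memv_img ?memvf.
by have /lker0P/eqP -> := fi; rewrite capv0.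
Qed.

Lemma inj_surj U V (f : 'Hom(U, V)) :
  injective f -> dim U = dim V -> forall y, exists x, f x = y.
Proof.
move=> fi dUV y; suff: y \in limg f by case/memv_imgP => x _ ->; exists x.
suff -> : limg f = fullv by exact: memvf.
apply/eqP; rewrite eqEdim subvf /= dimvf -dUV -dimvf limg_dim_eq //.
by have /lker0P/eqP -> := fi; rewrite capv0.
Qed.

Lemma vsp_iso_dim U V : dim U = dim V -> vsp_iso U V.
Proof.
move=> dUV; pose c := castmx (R := k) (erefl 1, dUV).
have cP a x y : c (a *: x + y) = a *: c x + c y.
  by rewrite /c; move: (dUV) x y; case: _ / => x y; rewrite !castmx_id.
pose f (u : U) : V := r2v (c (v2r u)).
have fl : linear f.
  by move=> a x y; rewrite /f [X in c X]linearP cP linearP.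
exists (HB.pack f (GRing.isSemilinear.Build k U V _ f
    (GRing.semilinear_linear fl)) : {linear U -> V}).
pose c' := castmx (R := k) (erefl 1, esym dUV).
have cK : cancel c c' by exact: castmxK.
have c'K : cancel c' c by exact: castmxKV.
exists (fun v => r2v (c' (v2r v))) => v /=.
  by rewrite /f r2vK cK v2rK.
by rewrite /f r2vK c'K v2rK.
Qed.

Lemma extend_by_zero U W (R : {vspace U}) (chi : 'Hom(subvs_of (R^C)%VS, W)) :
  exists phi : 'Hom(U, W),
    (forall u, u \in R -> phi u = 0) /\ (forall c, phi (vsval c) = chi c).
Proof.
have RC0 : (R^C :&: R = 0)%VS by rewrite capvC capv_compl.
have RC0' : (R :&: R^C = 0)%VS by exact: capv_compl.
have pl : linear (fun u => chi (vsproj (R^C)%VS (daddv_pi (R^C)%VS R u))).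
  by move=> a u v; rewrite !linearP.
exists (lin_map pl); split=> [u uR|c]; rewrite lin_mapE; last first.
  by rewrite daddv_pi_id ?subvsP // vsvalK.
have /(daddv_pi_add RC0) : u \in (R^C + R)%VS by rewrite addvC addv_complf memvf.
rewrite (daddv_pi_id RC0') // => /(canRL (addrK _)).
by rewrite subrr => ->; rewrite !linear0.
Qed.

End LinearMaps.

(** * Homomorphisms of modules *)

Section ModuleMaps.

Variables (k : fieldType) (A : falgType k).
Implicit Types M N P X : fdmod A.

Lemma midE M v : mfun (mid M) v = v.
Proof. exact: id_lfunE. Qed.

Lemma mkhomE M N (f : 'Hom(M, N))
  (fM : forall a v, f (act a v) = act a (f v)) v : mfun (mkhom fM) v = f v.
Proof. by []. Qed.

Lemma mfun0 M N v : mfun (0 : mhom M N) v = 0.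
Proof. by rewrite /mfun linear0 zero_lfunE. Qed.

Lemma mfun_suml M N n (f : 'I_n -> mhom M N) v :
  mfun (\sum_i f i) v = \sum_i mfun (f i) v.
Proof. by rewrite /mfun linear_sum sum_lfunE. Qed.

Lemma mcompA M N P X (h : mhom P X) (g : mhom N P) (f : mhom M N) :
  mcomp h (mcomp g f) = mcomp (mcomp h g) f.
Proof. by apply: mhom_ext => v; rewrite !mcompE. Qed.

Lemma mcompf1 M N (f : mhom M N) : mcomp f (mid M) = f.
Proof. by apply: mhom_ext => v; rewrite mcompE midE. Qed.

Lemma mcomp1f M N (f : mhom M N) : mcomp (mid N) f = f.
Proof. by apply: mhom_ext => v; rewrite mcompE midE. Qed.

Lemma mcomp0 M N P (f : mhom N P) : mcomp f (0 : mhom M N) = 0.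
Proof. by apply: mhom_ext => v; rewrite mcompE !mfun0 linear0. Qed.

Lemma mcomp0f M N P (f : mhom M N) : mcomp (0 : mhom N P) f = 0.
Proof. by apply: mhom_ext => v; rewrite mcompE !mfun0. Qed.

Lemma mcomp_linearr M N P (f : mhom N P) : linear (@mcomp _ _ M N P f).
Proof.
by move=> c g h; apply: mhom_ext => v; rewrite mfun_lin !mcompE mfun_lin linearP.
Qed.

Lemma mcomp_linearl M N P (f : mhom M N) : linear ((@mcomp _ _ M N P)^~ f).
Proof.
by move=> c g h; apply: mhom_ext => v; rewrite mfun_lin !mcompE mfun_lin.
Qed.

Lemma miso_bij M N (f : mhom M N) :
  injective (mfun f) -> msurj f -> miso f.
Proof.
move=> fi fs; pose g := (mfun f)^-1%VF.
have fl : lker (mfun f) == 0%VS by exact/lker0P.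
have fK v : g (mfun f v) = v by exact: lker0_lfunK.
have gK v : mfun f (g v) = v by have [w <-] := fs v; rewrite fK.
have gM a v : g (act a v) = act a (g v).
  by apply: fi; rewrite gK mfun_act gK.
exists (mkhom gM); split; apply: mhom_ext => v;
  by rewrite mcompE midE mkhomE ?fK ?gK.
Qed.

Lemma miso_inj M N (f : mhom M N) : miso f -> injective (mfun f).
Proof.
by case=> g [gf _] u v e; rewrite -(midE u) -(midE v) -gf !mcompE e.
Qed.

Lemma miso_surj M N (f : mhom M N) : miso f -> msurj f.
Proof. by case=> g [_ fg] y; exists (mfun g y); rewrite -mcompE fg midE. Qed.

Lemma miso_id M : miso (mid M).
Proof. by exists (mid M); rewrite mcomp1f. Qed.

Lemma miso_comp M N P (g : mhom N P) (f : mhom M N) :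
  miso g -> miso f -> miso (mcomp g f).
Proof.
move=> [g' [gg' g'g]] [f' [ff' f'f]]; exists (mcomp f' g'); split.
  by rewrite mcompA -(mcompA f') gg' mcompf1.
by rewrite mcompA -(mcompA g) f'f mcompf1.
Qed.

Definition isomorphic M N : Prop := exists f : mhom M N, miso f.

Lemma dim_mhom_iso M M' N N' : isomorphic M M' -> isomorphic N N' ->
  dim (mhom M N) = dim (mhom M' N').
Proof.
move=> [f [f' [f'f ff']]] [g [g' [g'g gg']]].
pose F (h : mhom M N) := mcomp g (mcomp h f').
have Fl : linear F by move=> c u v; rewrite /F mcomp_linearl mcomp_linearr.
apply: (@dim_inj_surj _ _ _ (lin_map Fl)) => [u v|u].
  rewrite !lin_mapE /F => /(congr1 (fun h => mcomp g' (mcomp h f))).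
  by rewrite -!mcompA f'f !mcompf1 !mcompA g'g !mcomp1f.
exists (mcomp g' (mcomp u f)); rewrite lin_mapE /F.
by rewrite -!mcompA ff' mcompf1 mcompA gg' mcomp1f.
Qed.

End ModuleMaps.

(** * The dimension of Hom(X, tau M) *)

Section DualBasis.

Variables (k : fieldType) (A : falgType k).
Implicit Types M N P X : fdmod A.

Lemma free_coord_linear n (i : 'I_n) :
  linear (fun x : freemod A n => (x : {ffun 'I_n -> A}) i : regmod A).
Proof. by move=> c x y; rewrite !ffunE. Qed.

Lemma free_coord_act n (i : 'I_n) a x :
  lin_map (free_coord_linear i) (act a x) = act a (lin_map (free_coord_linear i) x).
Proof. by rewrite !lin_mapE /= ffunE. Qed.

Definition free_coord n (i : 'I_n) : mhom (freemod A n) (regmod A) :=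
  mkhom (free_coord_act i).

Lemma free_coordE n (i : 'I_n) x :
  mfun (free_coord i) x = (x : {ffun 'I_n -> A}) i.
Proof. exact: lin_mapE. Qed.

(** A projective module is a direct summand of a free one; the x i are the
    images of the free generators, the f i the coordinates of a section. *)
Lemma dual_basis P : projective P ->
  exists n (x : 'I_n -> P) (f : 'I_n -> mhom P (regmod A)),
    forall p, p = \sum_i act (mfun (f i) p : A) (x i).
Proof.
move=> prP; pose x (i : 'I_(\dim {:P})) := (vbasis {:P})`_i.
have ps : msurj (free_map x).
  move=> y; exists [ffun i => (coord (vbasis {:P}) i y)%:A].
  rewrite free_mapE [RHS](coord_vbasis (memvf y)).
  apply: eq_bigr => i _; rewrite ffunE.
  by have := act_linearl (x i) (coord (vbasis {:P}) i y) 1 0;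
    rewrite addr0 act0 addr0 act1.
have [l lE] := prP _ _ _ (mid P) ps.
exists _, x, (fun i => mcomp (free_coord i) l) => p.
rewrite -{1}(midE p) -lE mcompE free_mapE; apply: eq_bigr => i _.
by rewrite mcompE free_coordE.
Qed.

Lemma factor_through_surj M N P (p : mhom M N) (v : mhom M P) :
  msurj p -> (forall x, mfun p x = 0 -> mfun v x = 0) ->
  exists w : mhom N P, mcomp w p = v.
Proof.
move=> ps vp; pose w := (mfun v \o (mfun p)^-1)%VF.
have pV y : mfun p ((mfun p)^-1%VF y) = y.
  by have [x <-] := ps y; apply: limg_lfunVK; rewrite memv_img ?memvf.
have wp x : w (mfun p x) = mfun v x.
  apply/eqP; rewrite -subr_eq0 comp_lfunE -linearB; apply/eqP/vp.
  by rewrite linearB /= pV subrr.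
have wM a y : w (act a y) = act a (w y).
  by have [x <-] := ps y; rewrite -mfun_act !wp mfun_act.
by exists (mkhom wM); apply: mhom_ext => x; rewrite mcompE mkhomE wp.
Qed.

End DualBasis.

Section RankOne.

Variables (k : fieldType) (A : falgType k) (P X : fdmod A).

Lemma rank_one_linear (f : mhom P (regmod A)) (x : X) :
  linear (fun p => act (mfun f p : A) x).
Proof. by move=> c p q; rewrite linearP act_linearl. Qed.

Lemma rank_one_act f (x : X) a p :
  lin_map (rank_one_linear f x) (act a p) = act a (lin_map (rank_one_linear f x) p).
Proof. by rewrite !lin_mapE mfun_act actM. Qed.

(** The image of f (x) x under the canonical map Hom(P, A) (x)_A X -> Hom(P, X),
    which is bijective for P projective. *)
Definition rank_one f (x : X) : mhom P X := mkhom (rank_one_act f x).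

Lemma rank_oneE f x p : mfun (rank_one f x) p = act (mfun f p : A) x.
Proof. by rewrite mkhomE lin_mapE. Qed.

Lemma rank_one_linearl x : linear (rank_one^~ x).
Proof.
move=> c f g; apply: mhom_ext => p; rewrite mfun_lin !rank_oneE mfun_lin.
exact: act_linearl.
Qed.

Lemma rank_one_linearr f : linear (rank_one f).
Proof.
by move=> c x y; apply: mhom_ext => p; rewrite mfun_lin !rank_oneE act_linearr.
Qed.

Lemma rank_one_actr f a x : rank_one f (act a x) = rank_one (homreg_act a f) x.
Proof.
by apply: mhom_ext => p; rewrite !rank_oneE homreg_actE actM.
Qed.

End RankOne.

(** For d : P1 -> P0 between projective modules and T the cokernel of
    Hom(d, A), the space Hom(X, D T) is compared with the functionals on
    Hom(P1, X) that vanish on the image R of Hom(P0, X), that is, with the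
    functionals on a complement C of R. The pairs (x, f) and (y, e) are dual
    bases of P1 and P0. *)
Section AuslanderReiten.

Variables (k : fieldType) (A : falgType k) (P1 P0 X : fdmod A).
Variable d : mhom P1 P0.

Definition comp_hom : 'Hom(mhom P0 X, mhom P1 X) :=
  lin_map (mcomp_linearl (P := X) d).

Lemma comp_homE v : comp_hom v = mcomp v d.
Proof. exact: lin_mapE. Qed.

Local Notation T := (mcoker (homreg_map d)).
Local Notation U := (limg (mfun (homreg_map d))).

Definition coker_proj : 'Hom(homreg P1, T) := quot_proj U.

Lemma coker_proj_act a h : coker_proj (act a h) = act a (coker_proj h).
Proof. exact (@quot_proj_act _ _ _ _ (@mimg_stable _ _ _ _ (homreg_map d)) a h). Qed.

Lemma coker_proj_comp (e : mhom P0 (regmod A)) : coker_proj (mcomp e d) = 0.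
Proof.
apply/eqP; rewrite quot_proj_eq0; apply/memv_imgP; exists e => /=; [exact: memvf|].
by rewrite [RHS]lfunE.
Qed.

Local Notation R := (limg comp_hom).
Local Notation C := (subvs_of (R^C)%VS).

Variables (n : nat) (x : 'I_n -> P1) (f : 'I_n -> mhom P1 (regmod A)).
Variables (m : nat) (y : 'I_m -> P0) (e : 'I_m -> mhom P0 (regmod A)).
Hypothesis xf : forall p, p = \sum_i act (mfun (f i) p : A) (x i).
Hypothesis ye : forall p, p = \sum_i act (mfun (e i) p : A) (y i).

(** The functional on Hom(P1, X) that g : X -> D T defines. The formula is
    forced by its values on the maps rank_one h z, see
    hom_functional_rank_one. *)
Definition hom_functional (g : mhom X (dual_right T)) (u : mhom P1 X) : k^o :=
  \sum_i (mfun g (mfun u (x i)) : 'Hom(T, k^o)) (coker_proj (f i)).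

Lemma hom_functional_linear g : linear (hom_functional g).
Proof.
move=> c u v; rewrite /hom_functional scaler_sumr -big_split /=.
by apply: eq_bigr => i _; rewrite mfun_lin linearP add_lfunE scale_lfunE.
Qed.

Lemma hom_functional_linearl u : linear (hom_functional^~ u).
Proof.
move=> c g h; rewrite /hom_functional scaler_sumr -big_split /=.
by apply: eq_bigr => i _; rewrite !(add_lfunE, scale_lfunE).
Qed.

Lemma hom_functional_rank_one g h z :
  hom_functional g (rank_one h z) = (mfun g z : 'Hom(T, k^o)) (coker_proj h).
Proof.
have hE : h = \sum_i homreg_act (mfun h (x i) : A) (f i).
  apply: mhom_ext => p; rewrite {1}(xf p) mfun_sum mfun_suml.
  by apply: eq_bigr => i _; rewrite mfun_act homreg_actE.
rewrite [in RHS]hE !linear_sum /=; apply: eq_bigr => i _.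
by rewrite rank_oneE mfun_act dual_actE -coker_proj_act.
Qed.

Lemma sum_rank_one (u : mhom P1 X) : u = \sum_i rank_one (f i) (mfun u (x i)).
Proof.
apply: mhom_ext => p; rewrite {1}(xf p) mfun_sum mfun_suml.
by apply: eq_bigr => i _; rewrite mfun_act rank_oneE.
Qed.

(** The dual basis of P0 writes v o d as a sum of maps rank_one (e j o d) _, and
    e j o d vanishes in T. *)
Lemma hom_functional_comp g (v : mhom P0 X) : hom_functional g (mcomp v d) = 0.
Proof.
have -> : mcomp v d = \sum_j rank_one (mcomp (e j) d) (mfun v (y j)).
  apply: mhom_ext => p; rewrite mcompE {1}(ye (mfun d p)) mfun_sum mfun_suml.
  by apply: eq_bigr => j _; rewrite mfun_act rank_oneE mcompE.
rewrite -(lin_mapE (hom_functional_linear g)) linear_sum /= big1 // => j _.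
by rewrite lin_mapE hom_functional_rank_one coker_proj_comp linear0.
Qed.

Definition hom_coker_functional (g : mhom X (dual_right T)) : 'Hom(C, k^o) :=
  (lin_map (hom_functional_linear g) \o linfun vsval)%VF.

Lemma hom_coker_functionalE g c :
  hom_coker_functional g c = hom_functional g (vsval c).
Proof. by rewrite comp_lfunE lin_mapE lfunE. Qed.

Lemma hom_coker_functional_linear : linear hom_coker_functional.
Proof.
move=> c g h; apply/lfunP => w.
by rewrite add_lfunE scale_lfunE !hom_coker_functionalE hom_functional_linearl.
Qed.

Lemma hom_coker_functional_inj : injective (lin_map hom_coker_functional_linear).
Proof.
apply/lker0P/eqP/vspaceP => g; rewrite memv0 memv_ker lin_mapE.
apply/eqP/eqP => [g0|->]; last by rewrite -(lin_mapE hom_coker_functional_linear) linear0.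
have psi0 u : hom_functional g u = 0.
  have : u \in (R + R^C)%VS by rewrite addv_complf memvf.
  case/memv_addP => _ /memv_imgP[v _ ->] [w wC ->].
  rewrite -(lin_mapE (hom_functional_linear g)) linearD /= !lin_mapE.
  rewrite hom_functional_comp add0r -(vsprojK wC) -hom_coker_functionalE g0.
  exact: zero_lfunE.
apply: mhom_ext => z; rewrite mfun0; apply/lfunP => t; rewrite zero_lfunE.
by rewrite -(psi0 (rank_one (vsval t) z)) hom_functional_rank_one quot_projK.
Qed.

(** A functional phi on Hom(P1, X) that vanishes on R is hit by
    g z = (t |-> phi (rank_one h z)), with h a representative of t in
    Hom(P1, A): changing h by some e0 o d does not change the value. *)
Lemma hom_coker_functional_surj (chi : 'Hom(C, k^o)) :
  exists g, hom_coker_functional g = chi.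
Proof.
have [phi [phiR phiC]] := extend_by_zero chi.
have phi_comp v : phi (mcomp v d) = 0.
  by rewrite -comp_homE phiR ?memv_img ?memvf.
have gl z : linear (fun t : T => phi (rank_one (vsval t) z)).
  by move=> c s t; rewrite linearP rank_one_linearl linearP.
have phi_proj h z : phi (rank_one (vsval (coker_proj h)) z) = phi (rank_one h z).
  have := quot_proj_sub U h; case/memv_imgP => e0 _ he.
  have hE : h = 1 *: precomp d e0 + vsval (coker_proj h).
    apply/eqP; rewrite scale1r -subr_eq; apply/eqP.
    by rewrite [LHS]he lfunE.
  rewrite [in RHS]hE rank_one_linearl scale1r linearD /=.
  have -> : rank_one (precomp d e0) z = mcomp (rank_one e0 z) d.
    by apply: mhom_ext => p; rewrite mcompE !rank_oneE mcompE.
  by rewrite phi_comp add0r.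
have gll : linear (fun z => lin_map (gl z) : dual_right T).
  move=> c z w; apply/lfunP => t.
  by rewrite add_lfunE scale_lfunE !lin_mapE rank_one_linearr linearP.
have gM a z : lin_map gll (act a z) = act a (lin_map gll z).
  apply/lfunP => t; rewrite dual_actE !lin_mapE rank_one_actr.
  exact/esym/phi_proj.
exists (mkhom gM); apply/lfunP => c; rewrite hom_coker_functionalE /hom_functional.
rewrite -phiC {2}(sum_rank_one (vsval c)) linear_sum.
apply: eq_bigr => i _; rewrite mkhomE !lin_mapE.
exact: phi_proj.
Qed.

Lemma dim_hom_dual_coker :
  (dim (mhom X (dual_right T)) + \dim R)%N = dim (mhom P1 X).
Proof.
have -> : dim (mhom X (dual_right T)) = dim 'Hom(C, k^o).
  apply: (dim_inj_surj hom_coker_functional_inj) => chi.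
  by have [g <-] := hom_coker_functional_surj chi; exists g; rewrite lin_mapE.
by rewrite dim_dual dim_subvs dimv_compl dimvf subnK // -dimvf dimvS ?subvf.
Qed.

End AuslanderReiten.

(** The map Hom(P0, X) -> Hom(P1, X) has rank dim Hom(P0, X) - dim Hom(M, X),
    because Hom(-, X) is left exact, and Hom(X, tau M) is dual to its
    cokernel. *)
Lemma dim_hom_tau (k : fieldType) (A : falgType k) (M X : fdmod A) :
  (dim (mhom X (tau M)) + dim (mhom (pcover M) X) =
   dim (mhom (pcover (syzygy M)) X) + dim (mhom M X))%N.
Proof.
have [pr0 p0s _] := pcoverP M; have [pr1 p1s _] := pcoverP (syzygy M).
have [m [y [e ye]]] := dual_basis pr0; have [n [x [f xf]]] := dual_basis pr1.
pose d := presentation M; pose p := pcover_map M.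
have kerE : \dim (lker (comp_hom X d)) = dim (mhom M X).
  have pi : injective (comp_hom X p).
    apply/lker0P/eqP/vspaceP => g; rewrite memv0 memv_ker comp_homE.
    apply/eqP/eqP => [gp|->]; last by rewrite mcomp0f.
    apply: mhom_ext => u; have [z <-] := p0s u.
    by rewrite -mcompE gp !mfun0.
  rewrite -[RHS]dimvf -(limg_dim_eq (f := comp_hom X p) (U := fullv)); last first.
    by have /lker0P/eqP -> := pi; rewrite capv0.
  congr (\dim _); apply/vspaceP => v; rewrite memv_ker comp_homE.
  apply/eqP/memv_imgP => [vd|[g _ ->]].
    have [u pu|g gE] := factor_through_surj p0s (v := v).
      have uK : u \in lker (mfun p) by rewrite memv_ker pu.
      have [z zE] := p1s (vsproj _ u).
      have := congr1 (fun h => mfun h z) vd; rewrite mcompE mfun0 => <-.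
      by rewrite mcompE zE subinclE vsprojK.
    by exists g; [exact: memvf | rewrite comp_homE].
  apply: mhom_ext => z; rewrite comp_homE mfun0 2!mcompE.
  have /eqP -> : mfun p (mfun d z) == 0.
    by rewrite -memv_ker mcompE subinclE subvsP.
  by rewrite linear0.
rewrite -(dim_hom_dual_coker X d xf ye) -kerE -[in LHS](dimvf (mhom (pcover M) X)).
rewrite -(limg_ker_dim (comp_hom X d) fullv) capfv.
by rewrite addnA addnAC.
Qed.

(** * Projective covers and kernels in categorical terms *)

Section Covers.

Variables (k : fieldType) (A : falgType k).
Implicit Types K M N P Q X : fdmod A.

Definition epi M N (f : mhom M N) : Prop :=
  forall P (g : mhom N P), mcomp g f = 0 -> g = 0.

Definition mono M N (f : mhom M N) : Prop :=
  forall P (g : mhom P M), mcomp f g = 0 -> g = 0.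

Lemma mcompBr M N P (f : mhom N P) (g h : mhom M N) :
  mcomp f (g - h) = mcomp f g - mcomp f h.
Proof. by rewrite -(lin_mapE (mcomp_linearr f)) linearB /= !lin_mapE. Qed.

Lemma mono_cancel M N P (f : mhom M N) (g h : mhom P M) :
  mono f -> mcomp f g = mcomp f h -> g = h.
Proof.
move=> fm e; apply/eqP; rewrite -subr_eq0; apply/eqP/fm.
by rewrite mcompBr e subrr.
Qed.

Lemma msurj_epi M N (f : mhom M N) : msurj f -> epi f.
Proof.
move=> fs P g gf; apply: mhom_ext => y; have [x <-] := fs y.
by rewrite -mcompE gf !mfun0.
Qed.

Definition mquot M (U : {vspace M}) (sU : stable U) : mhom M (quotmod sU) :=
  @mkhom _ _ M (quotmod sU) (quot_proj U) (quot_proj_act sU).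

(** The projection onto the cokernel vanishes on the image. *)
Lemma epi_msurj M N (f : mhom M N) : epi f -> msurj f.
Proof.
move=> fe y; have sU : stable (limg (mfun f)) by exact: mimg_stable.
have q0 : mquot sU = 0.
  apply: fe; apply: mhom_ext => x; rewrite mfun0 mcompE mkhomE.
  by apply/eqP; rewrite quot_proj_eq0 memv_img ?memvf.
have : y \in limg (mfun f).
  by rewrite -quot_proj_eq0 -[quot_proj _ y]/(mfun (mquot sU) y) q0 mfun0.
by case/memv_imgP => x _ ->; exists x.
Qed.

(** This form of superfluous kernels mentions only morphisms, and is therefore
    transported by equivalences. *)
Definition essential P M (p : mhom P M) : Prop :=
  forall N (g : mhom N P), msurj (mcomp p g) -> msurj g.

Lemma proj_coverE P M (p : mhom P M) :
  proj_cover p <-> [/\ projective P, msurj p & essential p].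
Proof.
split=> [] [pr ps h]; split=> //.
  move=> N g pgs y; have sU : stable (limg (mfun g)) by exact: mimg_stable.
  suff gT : limg (mfun g) = fullv.
    have : y \in limg (mfun g) by rewrite gT memvf.
    by case/memv_imgP => x _ ->; exists x.
  apply: h => //; apply/vspaceP => x; rewrite memvf.
  have [z zE] := pgs (mfun p x).
  rewrite -(subrK (mfun g z) x) addrC memv_add ?memv_img ?memvf //.
  by rewrite memv_ker linearB /= -mcompE zE subrr.
move=> U sU UT; apply/vspaceP => y; rewrite memvf.
have /h incls : msurj (mcomp p (subincl sU)).
  move=> m; have [x <-] := ps m.
  have : x \in (U + lker (mfun p))%VS by rewrite UT memvf.
  case/memv_addP => u uU [z]; rewrite memv_ker => /eqP zK ->.
  exists (vsproj U u); rewrite mcompE subinclE vsprojK //.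
  by rewrite linearD /= zK addr0.
by have [u <-] := incls y; rewrite subinclE subvsP.
Qed.

Lemma proj_cover_miso P M M' (p : mhom P M) (phi : mhom M M') :
  miso phi -> proj_cover p -> proj_cover (mcomp phi p).
Proof.
move=> [psi [psiK phiK]] /proj_coverE[pr ps pe]; apply/proj_coverE; split=> //.
  move=> y; have [x xE] := ps (mfun psi y); exists x.
  by rewrite mcompE xE -mcompE phiK midE.
move=> N g gs; apply: pe => y; have [z zE] := gs (mfun phi y); exists z.
by rewrite -[LHS]midE -psiK mcompE -[X in mfun psi X]mcompE mcompA zE -mcompE psiK midE.
Qed.

(** A lift l of p along q is onto because q is essential, so it has a section;
    the section is onto because p is essential, so l is invertible. *)
Lemma proj_cover_unique P Q M (p : mhom P M) (q : mhom Q M) :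
  proj_cover p -> proj_cover q -> exists2 l : mhom P Q, miso l & mcomp q l = p.
Proof.
move=> /proj_coverE[prP ps pe] /proj_coverE[prQ qs qe].
have [l lE] := prP _ _ q p qs; exists l => //.
have ls : msurj l by apply: qe; rewrite lE.
have [s sE] := prQ _ _ l (mid Q) ls.
have ss : msurj s by apply: pe; rewrite -lE -mcompA sE mcompf1.
exists s; split=> //; apply: mhom_ext => x; have [y <-] := ss x.
by rewrite mcompE -[X in mfun s X]mcompE sE !midE.
Qed.

Record is_kernel K P M (i : mhom K P) (p : mhom P M) : Prop := IsKernel {
  kernel_mono : mono i;
  kernel_comp : mcomp p i = 0;
  kernel_lift : forall X (f : mhom X P), mcomp p f = 0 ->
    exists g, mcomp i g = f }.

Lemma mker_is_kernel P M (p : mhom P M) : is_kernel (mkerincl p) p.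
Proof.
split=> [X g ig|| X f pf].
- apply: mhom_ext => x; apply: val_inj.
  have := congr1 (fun h => mfun h x) ig.
  by rewrite mcompE subinclE !mfun0.
- apply: mhom_ext => x; rewrite mcompE subinclE mfun0.
  by apply/eqP; rewrite -memv_ker subvsP.
have fK x : mfun f x \in lker (mfun p).
  by rewrite memv_ker -mcompE pf mfun0.
have gl : linear (fun x => vsproj (lker (mfun p)) (mfun f x) : mker p).
  by move=> c x y; rewrite !linearP.
have gM a x : lin_map gl (act a x) = act a (lin_map gl x).
  rewrite !lin_mapE mfun_act; apply: val_inj.
  by rewrite /= /sub_act !vsprojK // -mfun_act fK.
exists (mkhom gM); apply: mhom_ext => x.
by rewrite mcompE subinclE mkhomE lin_mapE vsprojK.
Qed.

Lemma kernel_unique K P M K' P' M' (i : mhom K P) (p : mhom P M)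
  (i' : mhom K' P') (p' : mhom P' M') (l : mhom P P') (phi : mhom M M') :
  is_kernel i p -> is_kernel i' p' -> miso l -> miso phi ->
  mcomp p' l = mcomp phi p -> isomorphic K K'.
Proof.
move=> [im pi iu] [i'm p'i' i'u] [l' [l'K lK]] [psi [psiK phiK]] sq.
have sq' : mcomp p l' = mcomp psi p'.
  rewrite -[LHS]mcomp1f -psiK -mcompA (mcompA phi) -sq -(mcompA p') lK.
  by rewrite mcompf1.
have [|a aE] := i'u _ (mcomp l i).
  by rewrite mcompA sq -mcompA pi mcomp0.
have [|b bE] := iu _ (mcomp l' i').
  by rewrite mcompA sq' -mcompA p'i' mcomp0.
exists a, b; split.
  apply: (mono_cancel im).
  by rewrite mcompA bE -mcompA aE mcompA l'K mcomp1f mcompf1.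
apply: (mono_cancel i'm).
by rewrite mcompA aE -mcompA bE mcompA lK mcomp1f mcompf1.
Qed.

End Covers.

(** * Equivalences preserve projective covers and syzygies *)

Section Equivalence.

Definition equivalence (k : fieldType) (A B : falgType k)
  (F : kfunctor A B) (G : kfunctor B A) : Prop :=
  natiso_id F G /\ natiso_id G F.

Lemma equivalence_sym (k : fieldType) (A B : falgType k)
  (F : kfunctor A B) (G : kfunctor B A) :
  equivalence F G -> equivalence G F.
Proof. by case. Qed.

(** The isomorphism N -> G (F N), composed with f, factors through G (F f). *)
Lemma natiso_faithful (k : fieldType) (A B : falgType k)
  (F : kfunctor A B) (G : kfunctor B A) M N (f : mhom M N) :
  natiso_id F G -> fmap F _ _ f = 0 -> f = 0.
Proof.
move=> [eta [etai etan]] Ff0; have := etan _ _ f.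
rewrite Ff0 linear0 mcomp0f; have [th [thK _]] := etai N.
by move/(congr1 (mcomp th)); rewrite mcompA thK mcomp1f mcomp0.
Qed.

Variables (k : fieldType) (A B : falgType k).
Variables (F : kfunctor A B) (G : kfunctor B A).
Hypothesis FG : equivalence F G.

Lemma equiv_faithful M N (f g : mhom M N) :
  fmap F _ _ f = fmap F _ _ g -> f = g.
Proof.
move=> e; apply/eqP; rewrite -subr_eq0; apply/eqP.
by apply: (natiso_faithful FG.1); rewrite linearB /= e subrr.
Qed.

(** The preimage of u is G u, conjugated by the natural isomorphism; that F
    sends it to u can be tested after applying G, which is faithful. *)
Lemma equiv_full M N (u : mhom (F M) (F N)) : exists f, fmap F M N f = u.
Proof.
have [[eta [etai etan]] _] := FG.
have [th [thK etaK]] := etai N; have [thM [_ etaKM]] := etai M.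
pose f := mcomp th (mcomp (fmap G _ _ u) (eta M)); exists f.
apply/eqP; rewrite -subr_eq0; apply/eqP/(natiso_faithful FG.2).
rewrite linearB /=; apply/eqP; rewrite subr_eq0; apply/eqP.
rewrite -[LHS]mcompf1 -etaKM mcompA -etan /f !mcompA etaK mcomp1f.
by rewrite -mcompA etaKM mcompf1.
Qed.

Lemma equiv_dim_mhom M N : dim (mhom M N) = dim (mhom (F M) (F N)).
Proof.
apply: (@dim_inj_surj _ _ _ (linfun (fmap F M N))) => [f g|u].
  by rewrite !lfunE; exact: equiv_faithful.
by have [f <-] := equiv_full u; exists f; rewrite lfunE.
Qed.

Lemma fmap_miso M N (f : mhom M N) : miso f -> miso (fmap F _ _ f).
Proof.
by move=> [g [gf fg]]; exists (fmap F _ _ g); rewrite -!fmap_comp gf fg !fmap_id.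
Qed.

End Equivalence.

Section Preservation.

Variables (k : fieldType) (A B : falgType k).

Lemma fmap_epi (F : kfunctor A B) (G : kfunctor B A) M N (f : mhom M N) :
  equivalence F G -> epi f -> epi (fmap F _ _ f).
Proof.
move=> [[eta [etai etan]] GF] fe P g gf; apply: (natiso_faithful GF).
have [th [_ etaK]] := etai N.
suff /(congr1 (fun h => mcomp h th)) : mcomp (fmap G _ _ g) (eta N) = 0.
  by rewrite -mcompA etaK mcompf1 mcomp0f.
by apply: fe; rewrite -mcompA etan mcompA -fmap_comp gf linear0 mcomp0f.
Qed.

Lemma fmap_epi_reflect (F : kfunctor A B) (G : kfunctor B A) M N (f : mhom M N) :
  equivalence F G -> epi (fmap F _ _ f) -> epi f.
Proof.
move=> [FG _] fe P g gf; apply: (natiso_faithful FG); apply: fe.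
by rewrite -fmap_comp gf linear0.
Qed.

Lemma fmap_mono (F : kfunctor A B) (G : kfunctor B A) M N (f : mhom M N) :
  equivalence F G -> mono f -> mono (fmap F _ _ f).
Proof.
move=> [[eta [etai etan]] GF] fm P g fg; apply: (natiso_faithful GF).
have [th [thK etaK]] := etai M; have [thN [thNK _]] := etai N.
suff /(congr1 (mcomp (eta M))) : mcomp th (fmap G _ _ g) = 0.
  by rewrite mcompA etaK mcomp1f mcomp0.
apply: fm; rewrite -[LHS]mcomp1f -thNK -mcompA (mcompA (eta N)) etan.
by rewrite -(mcompA _ (eta M)) (mcompA (eta M)) etaK mcomp1f -fmap_comp fg linear0 mcomp0.
Qed.

Lemma fmap_msurj (F : kfunctor A B) (G : kfunctor B A) M N (f : mhom M N) :
  equivalence F G -> msurj f <-> msurj (fmap F _ _ f).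
Proof.
move=> FG; split=> /msurj_epi fe; apply: epi_msurj; first exact: fmap_epi FG fe.
exact: fmap_epi_reflect FG fe.
Qed.

End Preservation.

Section CoverPreservation.

Variables (k : fieldType) (A B : falgType k).
Variables (F : kfunctor A B) (G : kfunctor B A).
Hypothesis FG : equivalence F G.
Let GF := equivalence_sym FG.

(** A lifting problem for F P is moved by G to one for P, and the solution is
    moved back by fullness. *)
Lemma fmap_projective P : projective P -> projective (F P).
Proof.
have [eta [etai _]] := FG.1; have [th [thK etaK]] := etai P.
move=> prP M N g h gs.
have [l lE] := prP _ _ _ (mcomp (fmap G _ _ h) (eta P)) ((fmap_msurj g GF).1 gs).
have [l' l'E] := equiv_full GF (mcomp l th); exists l'.
apply: (equiv_faithful GF).
by rewrite fmap_comp l'E mcompA lE -mcompA etaK mcompf1.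
Qed.

Lemma fmap_essential P M (p : mhom P M) : essential p -> essential (fmap F _ _ p).
Proof.
have [eta [etai etan]] := FG.1; move=> pe N g /(fmap_msurj _ GF).1.
rewrite fmap_comp => pgs; apply/(fmap_msurj _ GF).
have [thP [thPK etaPK]] := etai P; have [th [thK etaK]] := etai M.
have sq : mcomp p thP = mcomp th (fmap G _ _ (fmap F _ _ p)).
  rewrite -[LHS]mcomp1f -thK -mcompA (mcompA (eta M)) etan.
  by rewrite -(mcompA _ (eta P)) etaPK mcompf1.
have : msurj (mcomp thP (fmap G _ _ g)).
  apply: pe => y; have [z zE] := pgs (mfun (eta M) y); exists z.
  by rewrite mcompA sq -mcompA mcompE zE -mcompE thK midE.
move=> gs y; have [z zE] := gs (mfun thP y); exists z.
have thPi : miso thP by exists (eta P).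
by apply: (miso_inj thPi); rewrite -mcompE.
Qed.

Lemma fmap_proj_cover P M (p : mhom P M) :
  proj_cover p -> proj_cover (fmap F _ _ p).
Proof.
move=> /proj_coverE[pr ps pe]; apply/proj_coverE; split.
- exact: fmap_projective.
- by apply/(fmap_msurj _ FG).
- exact: fmap_essential.
Qed.

Lemma fmap_kernel K P M (i : mhom K P) (p : mhom P M) :
  is_kernel i p -> is_kernel (fmap F _ _ i) (fmap F _ _ p).
Proof.
case=> im pi iu; split; first exact: fmap_mono FG im.
  by rewrite -fmap_comp pi linear0.
have [eta [etai etan]] := FG.1 => X f pf.
have [thP [thPK etaPK]] := etai P; have [th [thK etaK]] := etai M.
have [|g gE] := iu _ (mcomp thP (fmap G _ _ f)).
  rewrite -[LHS]mcomp1f -thK -mcompA (mcompA (eta M)) etan.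
  rewrite -(mcompA _ (eta P)) (mcompA (eta P)) etaPK mcomp1f -fmap_comp pf.
  by rewrite linear0 mcomp0.
have [g' g'E] := equiv_full GF (mcomp (eta K) g); exists g'.
apply: (equiv_faithful GF).
by rewrite fmap_comp g'E mcompA -etan -mcompA gE mcompA etaPK mcomp1f.
Qed.

Lemma equiv_cover_syzygy M M' : isomorphic (F M) M' ->
  isomorphic (F (pcover M)) (pcover M') /\
  isomorphic (F (syzygy M)) (syzygy M').
Proof.
case=> phi phii.
have [l li lE] := proj_cover_unique
  (proj_cover_miso phii (fmap_proj_cover (pcoverP M))) (pcoverP M').
split; first by exists l.
apply: (kernel_unique (fmap_kernel (mker_is_kernel (pcover_map M)))
  (mker_is_kernel (pcover_map M')) li phii lE).
Qed.

Lemma equiv_iter_syzygy n M M' : isomorphic (F M) M' ->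
  isomorphic (F (iter n (@syzygy k A) M)) (iter n (@syzygy k B) M').
Proof.
by move=> FM; elim: n => //= n IHn; have [] := equiv_cover_syzygy IHn.
Qed.

Lemma equiv_dim_hom_iso M N M' N' : isomorphic (F M) M' -> isomorphic (F N) N' ->
  dim (mhom M N) = dim (mhom M' N').
Proof. by move=> FM FN; rewrite (equiv_dim_mhom FG); exact: dim_mhom_iso. Qed.

(** The formula of dim_hom_tau expresses the dimension of Hom(X, tau_n M)
    through Hom spaces and projective covers of syzygies. *)
Lemma equiv_dim_hom_tau_n n M M' X X' :
  isomorphic (F M) M' -> isomorphic (F X) X' ->
  dim (mhom X (tau_n n M)) = dim (mhom X' (tau_n n M')).
Proof.
move=> FM FX; have FN := equiv_iter_syzygy n.-1 FM.
have [FP0 FK] := equiv_cover_syzygy FN.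
have [FP1 _] := equiv_cover_syzygy FK.
have := dim_hom_tau (iter n.-1 (@syzygy k A) M) X.
rewrite (equiv_dim_hom_iso FP0 FX) (equiv_dim_hom_iso FP1 FX).
by rewrite (equiv_dim_hom_iso FN FX) -dim_hom_tau => /addIn.
Qed.

End CoverPreservation.

(** * Duality and the conjugate of a functor by the duality *)

Section DualMap.

Variables (k : fieldType) (A B : falgType k) (s : {linear B -> A}).
Hypotheses (s1 : s 1 = 1) (sM : forall x y, s (x * y) = s y * s x).
Local Notation D := (dual_along s1 sM).

Lemma dual_comp_linear (M N : fdmod A) (f : mhom M N) :
  linear (fun phi : D N => ((phi : 'Hom(N, k^o)) \o mfun f)%VF : D M).
Proof.
move=> c p q; apply/lfunP => v.
by rewrite !(add_lfunE, scale_lfunE, comp_lfunE).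
Qed.

Lemma dual_comp_act (M N : fdmod A) (f : mhom M N) b phi :
  lin_map (dual_comp_linear f) (act b phi) = act b (lin_map (dual_comp_linear f) phi).
Proof.
rewrite !lin_mapE; apply/lfunP => v.
by rewrite comp_lfunE !dual_actE comp_lfunE mfun_act.
Qed.

Definition dual_map (M N : fdmod A) (f : mhom M N) : mhom (D N) (D M) :=
  mkhom (dual_comp_act f).

Lemma dual_mapE M N (f : mhom M N) (phi : D N) v :
  (mfun (dual_map f) phi : 'Hom(M, k^o)) v = (phi : 'Hom(N, k^o)) (mfun f v).
Proof. by rewrite mkhomE lin_mapE comp_lfunE. Qed.

Lemma dual_map_linear M N : linear (@dual_map M N).
Proof.
move=> c f g; apply: mhom_ext => phi; apply/lfunP => v.
by rewrite mfun_lin add_lfunE scale_lfunE !dual_mapE mfun_lin linearP.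
Qed.

Lemma dual_map_id M : dual_map (mid M) = mid (D M).
Proof.
by apply: mhom_ext => phi; apply/lfunP => v; rewrite dual_mapE !midE.
Qed.

Lemma dual_map_comp M N P (g : mhom N P) (f : mhom M N) :
  dual_map (mcomp g f) = mcomp (dual_map f) (dual_map g).
Proof.
apply: mhom_ext => phi; apply/lfunP => v.
by rewrite dual_mapE !mcompE !dual_mapE.
Qed.

Lemma dual_map_miso M N (f : mhom M N) : miso f -> miso (dual_map f).
Proof.
by move=> [g [gf fg]]; exists (dual_map g); rewrite -!dual_map_comp gf fg !dual_map_id.
Qed.

End DualMap.

Section Bidual.

Variables (k : fieldType) (A B : falgType k).
Variables (s : {linear B -> A}) (t : {linear A -> B}).
Hypotheses (s1 : s 1 = 1) (sM : forall x y, s (x * y) = s y * s x).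
Hypotheses (t1 : t 1 = 1) (tM : forall x y, t (x * y) = t y * t x).
Hypothesis tK : cancel t s.
Local Notation D := (dual_along s1 sM).
Local Notation D' := (dual_along t1 tM).

Lemma eval_linear (U : vectType k) (v : U) : linear (fun phi : 'Hom(U, k^o) => phi v).
Proof. by move=> c p q; rewrite add_lfunE scale_lfunE. Qed.

Definition eval_at (U : vectType k) (v : U) : 'Hom('Hom(U, k^o), k^o) :=
  lin_map (eval_linear v).

Lemma eval_atE (U : vectType k) (v : U) phi : eval_at v phi = phi v.
Proof. exact: lin_mapE. Qed.

Lemma eval_at_linear (U : vectType k) : linear (@eval_at U).
Proof.
by move=> c u v; apply/lfunP => phi; rewrite add_lfunE scale_lfunE !eval_atE linearP.
Qed.

Lemma eval_act (M : fdmod A) a (v : M) :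
  lin_map (@eval_at_linear M : linear (@eval_at M : M -> D' (D M))) (act a v)
  = act a (lin_map (@eval_at_linear M : linear (@eval_at M : M -> D' (D M))) v).
Proof.
rewrite !lin_mapE; apply/lfunP => phi.
by rewrite dual_actE !eval_atE dual_actE tK.
Qed.

Definition bidual (M : fdmod A) : mhom M (D' (D M)) := mkhom (@eval_act M).

Lemma bidualE M v (phi : D M) :
  (mfun (bidual M) v : 'Hom(D M, k^o)) phi = (phi : 'Hom(M, k^o)) v.
Proof. by rewrite mkhomE lin_mapE eval_atE. Qed.

Lemma functional_ext (U : vectType k) (v : U) :
  (forall phi : 'Hom(U, k^o), phi v = 0) -> v = 0.
Proof.
move=> v0; rewrite (coord_vbasis (memvf v)) big1 // => i _.
have cl : linear (coord (vbasis {:U}) i : U -> k^o) by exact: linearP.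
by have := v0 (lin_map cl); rewrite lin_mapE => ->; rewrite scale0r.
Qed.

Lemma bidual_miso M : miso (bidual M).
Proof.
have bi : injective (mfun (bidual M)).
  apply/lker0P/eqP/vspaceP => v; rewrite memv0 memv_ker.
  apply/eqP/eqP => [v0|->]; last by rewrite linear0.
  by apply: functional_ext => phi; rewrite -bidualE v0 zero_lfunE.
apply: miso_bij => //; apply: inj_surj bi _.
by rewrite -[RHS]/(dim 'Hom('Hom(M, k^o), k^o)) !dim_dual.
Qed.

Lemma bidual_nat M N (f : mhom M N) :
  mcomp (bidual N) f = mcomp (dual_map t1 tM (dual_map s1 sM f)) (bidual M).
Proof.
apply: mhom_ext => v; apply/lfunP => phi.
by rewrite !mcompE bidualE dual_mapE bidualE dual_mapE.
Qed.

End Bidual.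

Section FromConverse.

Variables (k : fieldType) (A : falgType k).

Definition from_converse (a : A^c) : A := a.

Lemma from_converse_is_linear : linear from_converse.
Proof. by []. Qed.

HB.instance Definition _ :=
  GRing.isSemilinear.Build k A^c A _ from_converse
    (GRing.semilinear_linear from_converse_is_linear).

Lemma from_converse1 : from_converse 1 = 1. Proof. by []. Qed.

Lemma from_converseM (x y : A^c) :
  from_converse (x * y) = from_converse y * from_converse x.
Proof. by []. Qed.

Definition dual_left (M : fdmod A) : fdmod A^c :=
  dual_along from_converse1 from_converseM M.

Definition dual_left_map M N (f : mhom M N) : mhom (dual_left N) (dual_left M) :=
  dual_map from_converse1 from_converseM f.

Definition dual_right_map (M N : fdmod A^c) (f : mhom M N) :
  mhom (dual_right N) (dual_right M) :=
  dual_map (@to_converse1 k A) (@to_converseM k A) f.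

Lemma from_converseK : cancel from_converse (@to_converse k A).
Proof. by []. Qed.

Lemma to_converseK : cancel (@to_converse k A) from_converse.
Proof. by []. Qed.

Definition bidual_left (M : fdmod A^c) : mhom M (dual_left (dual_right M)) :=
  bidual (@to_converse1 k A) (@to_converseM k A) from_converse1 from_converseM
    from_converseK M.

Definition bidual_right (M : fdmod A) : mhom M (dual_right (dual_left M)) :=
  bidual from_converse1 from_converseM (@to_converse1 k A) (@to_converseM k A)
    to_converseK M.

End FromConverse.

(** The functor D F D from right A-modules to right B-modules. *)
Section ConverseFunctor.

Variables (k : fieldType) (A B : falgType k) (F : kfunctor A B).

Definition converse_obj (M : fdmod A^c) : fdmod B^c :=
  dual_left (F (dual_right M)).

Definition converse_fmap M N (f : mhom M N) :
  mhom (converse_obj M) (converse_obj N) :=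
  dual_left_map (fmap F _ _ (dual_right_map f)).

Lemma converse_fmap_linear M N : linear (@converse_fmap M N).
Proof.
move=> c f g; rewrite /converse_fmap /dual_right_map dual_map_linear linearP.
by rewrite /dual_left_map dual_map_linear.
Qed.

Definition converse_map M N :
    {linear mhom M N -> mhom (converse_obj M) (converse_obj N)} :=
  HB.pack (@converse_fmap M N)
    (GRing.isSemilinear.Build k _ _ _ (@converse_fmap M N)
      (GRing.semilinear_linear (@converse_fmap_linear M N))).

Lemma converse_map_id M : converse_map M M (mid M) = mid (converse_obj M).
Proof.
rewrite /= /converse_fmap /dual_right_map dual_map_id fmap_id.
exact: dual_map_id.
Qed.

Lemma converse_map_comp M N P (g : mhom N P) (f : mhom M N) :
  converse_map M P (mcomp g f) = mcomp (converse_map N P g) (converse_map M N f).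
Proof.
rewrite /= /converse_fmap /dual_right_map dual_map_comp fmap_comp.
exact: dual_map_comp.
Qed.

Definition converse_functor : kfunctor A^c B^c :=
  KFunctor converse_map_id converse_map_comp.

End ConverseFunctor.

Lemma natiso_inverse (k : fieldType) (A B : falgType k)
  (F : kfunctor A B) (G : kfunctor B A) : natiso_id F G ->
  exists th : forall M : fdmod A, mhom (G (F M)) M,
    (forall M, miso (th M)) /\
    forall M N (f : mhom M N),
      mcomp f (th M) = mcomp (th N) (fmap G _ _ (fmap F _ _ f)).
Proof.
move=> [eta [etai etan]]; exists (fun M => projT1 (cid (etai M))).
split=> [M|M N f].
  by case: cid => g [gK Kg] /=; exists (eta M).
case: cid => g [gK Kg] /=; case: cid => h [hK Kh] /=.
rewrite -[LHS]mcomp1f -hK -mcompA (mcompA (eta N)) etan.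
by rewrite -(mcompA _ (eta M)) Kg mcompf1.
Qed.

Lemma bidual_right_inverse (k : fieldType) (A : falgType k) :
  exists ev : forall M : fdmod A, mhom (dual_right (dual_left M)) M,
    (forall M, miso (ev M)) /\
    forall M N (f : mhom M N),
      mcomp f (ev M) = mcomp (ev N) (dual_right_map (dual_left_map f)).
Proof.
have evi (M : fdmod A) : miso (bidual_right M) by exact: bidual_miso.
exists (fun M => projT1 (cid (evi M))).
split=> [M|M N f].
  by case: cid => g [gK Kg] /=; exists (bidual_right M).
case: cid => g [gK Kg] /=; case: cid => h [hK Kh] /=.
rewrite -[LHS]mcomp1f -hK -mcompA (mcompA (bidual_right N)) bidual_nat.
by rewrite -(mcompA _ (bidual_right M)) Kg mcompf1.
Qed.

(** D G D D F D is isomorphic to D G F D, hence to D D and to the identity. The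
    inverse isomorphisms D D -> 1 and G F -> 1 are composed before dualizing,
    since D is contravariant. *)
Lemma converse_natiso (k : fieldType) (A B : falgType k)
  (F : kfunctor A B) (G : kfunctor B A) :
  natiso_id F G -> natiso_id (converse_functor F) (converse_functor G).
Proof.
move=> FG; have [th [thi thn]] := natiso_inverse FG.
have [ev [evi evn]] := bidual_right_inverse B.
pose s (N : fdmod A) : mhom (G (dual_right (dual_left (F N)))) N :=
  mcomp (th N) (fmap G _ _ (ev (F N))).
have si N : miso (s N).
  by apply: miso_comp (thi N) _; apply: fmap_miso (evi _).
have sn (M N : fdmod A) (h : mhom M N) : mcomp h (s M) =
    mcomp (s N) (fmap G _ _ (dual_right_map (dual_left_map (fmap F _ _ h)))).
  by rewrite mcompA thn -mcompA -fmap_comp evn fmap_comp mcompA.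
exists (fun M => mcomp (dual_left_map (s (dual_right M))) (bidual_left M)).
split=> [M|M N f].
  by apply: miso_comp; [apply: dual_map_miso (si _) | exact: bidual_miso].
rewrite -mcompA bidual_nat -/(bidual_left M) !mcompA; congr mcomp.
by rewrite -!dual_map_comp; congr dual_map; exact: sn.
Qed.

Lemma converse_equivalence (k : fieldType) (A B : falgType k)
  (F : kfunctor A B) (G : kfunctor B A) :
  equivalence F G -> equivalence (converse_functor F) (converse_functor G).
Proof. by case=> FG GF; split; exact: converse_natiso. Qed.

(** * Functors with an action of a second algebra *)

(** E together with a map A x B -> E that makes it the tensor product of A and B.
    Both orders of the factors of one tensor product are of this kind, so that
    functors can be applied to either side of a bimodule. *)
Record tensor_structure (k : fieldType) (A B E : falgType k) := TensorStructure {
  tpure : A -> B -> E;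
  tpure_bilin : bilin tpure;
  tpureM : forall a b a' b', tpure a b * tpure a' b' = tpure (a * a') (b * b');
  tpure1 : tpure 1 1 = 1;
  tlift : forall V : lmodType k, (A -> B -> V) -> E -> V;
  tlift_linear : forall (V : lmodType k) (f : A -> B -> V), linear (tlift f);
  tlift_pure : forall (V : lmodType k) (f : A -> B -> V) a b,
    bilin f -> tlift f (tpure a b) = f a b;
  tpure_ext : forall (V : lmodType k) (f g : E -> V), linear f -> linear g ->
    (forall a b, f (tpure a b) = g (tpure a b)) -> f =1 g
}.

Definition tensor_tensor (k : fieldType) (A B : falgType k) :
    tensor_structure A B (tensor A B) :=
  TensorStructure (@pure_bilin k A B) (@pureM k A B) (erefl _)
    (@tensor_lift_is_linear k A B) (@tensor_lift_pure k A B)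
    (@tensor_ext k A B).

Section Flip.

Variables (k : fieldType) (A B E : falgType k) (T : tensor_structure A B E).

Lemma bilin_flip (V : lmodType k) (f : A -> B -> V) :
  bilin f -> bilin (fun b a => f a b).
Proof. by case. Qed.

Lemma flip_pure (V : lmodType k) (f : B -> A -> V) b a :
  bilin f -> tlift T (fun a b => f b a) (tpure T a b) = f b a.
Proof. by move=> [fl fr]; rewrite tlift_pure. Qed.

Definition tensor_flip : tensor_structure B A E :=
  @TensorStructure k B A E (fun b a => tpure T a b) (bilin_flip (tpure_bilin T))
    (fun b a b' a' => tpureM T a b a' b') (tpure1 T)
    (fun V f => tlift T (fun a b => f b a))
    (fun V f => tlift_linear T (fun a b => f b a))
    (fun V f b a => @flip_pure V f b a)
    (fun V f g fl gl fg => tpure_ext (t := T) fl gl (fun a b => fg b a)).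

End Flip.

Section Biactions.

Variables (k : fieldType) (A B E : falgType k) (T : tensor_structure A B E).
Implicit Types M N : fdmod E.

Lemma res_linearl M (v : M) : linear (fun a : A => act (tpure T a 1) v).
Proof. by move=> c a b; rewrite (tpure_bilin T).2 act_linearl. Qed.

Lemma res_linearr M a : linear (@act k E M (tpure T a 1)).
Proof. exact: act_linearr. Qed.

Lemma res_act1 M (v : M) : act (tpure T 1 1) v = v.
Proof. by rewrite tpure1 act1. Qed.

Lemma res_actM M a b (v : M) :
  act (tpure T (a * b) 1) v = act (tpure T a 1) (act (tpure T b 1) v).
Proof. by rewrite -actM tpureM mulr1. Qed.

Definition res M : fdmod A :=
  @FdMod k A M (fun a v => act (tpure T a 1) v) (@res_linearl M) (@res_linearr M)
    (@res_act1 M) (@res_actM M).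

Lemma res_actE M a (v : M) : act (f := res M) a v = act (tpure T a 1) v.
Proof. by []. Qed.

Lemma coact_subproof M b a (v : res M) :
  actf M (tpure T 1 b) (act (f := res M) a v) =
  act (f := res M) a (actf M (tpure T 1 b) v).
Proof. by rewrite !res_actE !actfE -!actM !tpureM !mulr1 !mul1r. Qed.

(** The second factor acts on the A-module res M by endomorphisms. *)
Definition coact M (b : B) : mhom (res M) (res M) :=
  @mkhom k A (res M) (res M) _ (@coact_subproof M b).

Lemma coactE M b v : mfun (coact M b) v = act (tpure T 1 b) v :> M.
Proof. exact: actfE. Qed.

Lemma coact_linear M : linear (coact M).
Proof.
move=> c a b; apply: mhom_ext => v.
by rewrite mfun_lin !coactE (tpure_bilin T).1 act_linearl.
Qed.

Lemma coact1 M : coact M 1 = mid (res M).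
Proof. by apply: mhom_ext => v; rewrite coactE midE tpure1 act1. Qed.

Lemma coactM M a b : coact M (a * b) = mcomp (coact M a) (coact M b).
Proof.
by apply: mhom_ext => v; rewrite mcompE !coactE -actM tpureM mulr1.
Qed.

Lemma res_map_subproof M N (f : mhom M N) a (v : res M) :
  mfun f (act (f := res M) a v) = act (f := res N) a (mfun f v).
Proof. exact: mfun_act. Qed.

Definition res_map M N (f : mhom M N) : mhom (res M) (res N) :=
  @mkhom k A (res M) (res N) _ (@res_map_subproof M N f).

Lemma res_mapE M N (f : mhom M N) v : mfun (res_map f) v = mfun f v.
Proof. by []. Qed.

Lemma res_map_coact M N (f : mhom M N) b :
  mcomp (res_map f) (coact M b) = mcomp (coact N b) (res_map f).
Proof.
by apply: mhom_ext => v; rewrite !mcompE !coactE !res_mapE -mfun_act -coactE.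
Qed.

(** A homomorphism over both factors is one over E, because E is spanned by
    pure tensors. *)
Lemma biaction_hom M N (f : mhom (res M) (res N)) :
  (forall b, mcomp f (coact M b) = mcomp (coact N b) f) ->
  exists g : mhom M N, res_map g = f.
Proof.
move=> fB.
have fM e v : (mfun f : 'Hom(M, N)) (act (f := M) e v) = act (f := N) e (mfun f v).
  apply: (tpure_ext (t := T) (f := fun e => (mfun f : 'Hom(M, N)) (act (f := M) e v))
    (g := fun e => act (f := N) e (mfun f v))) => [c x y|c x y|a b].
  - by rewrite act_linearl linearP.
  - exact: act_linearl.
  have -> : tpure T a b = tpure T a 1 * tpure T 1 b by rewrite tpureM mul1r mulr1.
  rewrite !actM -[act (tpure T 1 b) (mfun f v)]coactE.
  rewrite -mcompE -fB mcompE -[RHS](res_actE a) -mfun_act.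
  by rewrite (coactE b v).
by exists (mkhom fM); apply: mhom_ext.
Qed.

(** Conversely, an A-module with commuting endomorphisms r b, multiplicative
    in b, becomes an E-module on the same space. *)
Section Amalgam.

Variables (N : fdmod A) (r : B -> mhom N N).
Hypotheses (rl : linear r) (r1 : r 1 = mid N).
Hypothesis rM : forall a b, r (a * b) = mcomp (r a) (r b).

Definition amalgam_act (e : E) (v : N) : N :=
  tlift T (fun a b => act a (mfun (r b) v)) e.

Lemma amalgam_bilin v : bilin (fun a b => act a (mfun (r b) v)).
Proof.
split=> x c y z; last exact: act_linearl.
by rewrite rl mfun_lin linearP.
Qed.

Lemma amalgam_act_pure a b v :
  amalgam_act (tpure T a b) v = act a (mfun (r b) v).
Proof. by rewrite /amalgam_act tlift_pure //; exact: amalgam_bilin. Qed.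

Lemma amalgam_linearl v : linear (amalgam_act^~ v).
Proof. exact: tlift_linear. Qed.

Lemma amalgam_linearr e : linear (amalgam_act e).
Proof.
move=> c u v; have ll := amalgam_linearl.
apply: (tpure_ext (t := T) (f := fun e => amalgam_act e (c *: u + v))
  (g := fun e => c *: amalgam_act e u + amalgam_act e v)) => [||a b].
- exact: ll.
- by move=> d x y; rewrite !ll scalerDr addrACA !scalerDr !scalerA mulrC.
by rewrite !amalgam_act_pure !linearP.
Qed.

Lemma amalgam_act1 v : amalgam_act 1 v = v.
Proof. by rewrite -(tpure1 T) amalgam_act_pure act1 r1 midE. Qed.

Lemma amalgam_actM x y v : amalgam_act (x * y) v = amalgam_act x (amalgam_act y v).
Proof.
have ll := amalgam_linearl; have lr := amalgam_linearr.
apply: (tpure_ext (t := T) (f := fun x => amalgam_act (x * y) v)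
  (g := fun x => amalgam_act x (amalgam_act y v))) => [||a b].
- by move=> c u w; rewrite mulrDl -scalerAl ll.
- exact: ll.
apply: (tpure_ext (t := T) (f := fun y => amalgam_act (_ * y) v)
  (g := fun y => amalgam_act _ (amalgam_act y v))) => [||a' b'].
- by move=> c u w; rewrite mulrDr -scalerAr ll.
- by move=> c u w; rewrite ll lr.
by rewrite tpureM !amalgam_act_pure rM mcompE actM mfun_act.
Qed.

Definition amalgam : fdmod E :=
  FdMod amalgam_linearl amalgam_linearr amalgam_act1 amalgam_actM.

(** The two actions of A on the space N agree because r 1 is the identity. *)
Lemma to_amalgam_subproof a (v : N) :
  (\1%VF : 'End(N)) (act a v) = act (f := res amalgam) a ((\1%VF : 'End(N)) v).
Proof. by rewrite !id_lfunE res_actE /= amalgam_act_pure r1 midE. Qed.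

Definition to_amalgam : mhom N (res amalgam) :=
  @mkhom k A N (res amalgam) _ to_amalgam_subproof.

Lemma to_amalgamE v : mfun to_amalgam v = v.
Proof. exact: id_lfunE. Qed.

Lemma to_amalgam_miso : miso to_amalgam.
Proof.
apply: miso_bij => [u v|y]; first by rewrite !to_amalgamE.
by exists y; rewrite to_amalgamE.
Qed.

Lemma to_amalgam_coact b :
  mcomp to_amalgam (r b) = mcomp (coact amalgam b) to_amalgam.
Proof.
apply: mhom_ext => v; rewrite !mcompE !to_amalgamE coactE.
by rewrite [RHS]amalgam_act_pure act1.
Qed.

End Amalgam.

End Biactions.

Section ResMap.

Variables (k : fieldType) (A B E : falgType k) (T : tensor_structure A B E).
Implicit Types M N P : fdmod E.

Lemma res_map_inj M N (f g : mhom M N) : res_map T f = res_map T g -> f = g.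
Proof. by move=> e; apply: mhom_ext => v; exact: (congr1 (fun h : mhom (res T M) (res T N) => mfun h v) e). Qed.

Lemma res_map_linear M N : linear (@res_map k A B E T M N).
Proof.
move=> c f g; apply: mhom_ext => v.
exact (etrans (mfun_lin c f g v)
  (esym (mfun_lin c (res_map T f) (res_map T g) v))).
Qed.

Lemma res_map_id M : res_map T (mid M) = mid (res T M).
Proof. by apply: mhom_ext => v; rewrite !midE. Qed.

Lemma res_map_comp M N P (g : mhom N P) (f : mhom M N) :
  res_map T (mcomp g f) = mcomp (res_map T g) (res_map T f).
Proof. by apply: mhom_ext => v; rewrite !mcompE. Qed.

Lemma res_map_miso M N (f : mhom M N) : miso (res_map T f) -> miso f.
Proof.
move=> fi; apply: miso_bij => [u v|y]; first exact: (miso_inj fi).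
by have [x xE] := miso_surj fi y; exists x.
Qed.

End ResMap.

(** The functor on E-modules that applies F to the underlying A-module and lets
    B act through F. *)
Section Lift.

Variables (k : fieldType) (A A' B E E' : falgType k).
Variables (T : tensor_structure A B E) (T' : tensor_structure A' B E').
Variable F : kfunctor A A'.
Implicit Types M N P : fdmod E.

Definition lift_coact M (b : B) : mhom (F (res T M)) (F (res T M)) :=
  fmap F _ _ (coact T M b).

Lemma lift_coact_linear M : linear (lift_coact M).
Proof. by move=> c a b; rewrite /lift_coact coact_linear linearP. Qed.

Lemma lift_coact1 M : lift_coact M 1 = mid _.
Proof. by rewrite /lift_coact coact1 fmap_id. Qed.

Lemma lift_coactM M a b :
  lift_coact M (a * b) = mcomp (lift_coact M a) (lift_coact M b).
Proof. by rewrite /lift_coact coactM fmap_comp. Qed.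

Definition lift_obj M : fdmod E' :=
  amalgam T' (@lift_coact_linear M) (@lift_coact1 M) (@lift_coactM M).

Lemma lift_act_pure M a b (v : F (res T M)) :
  act (f := lift_obj M) (tpure T' a b) v = act a (mfun (lift_coact M b) v).
Proof. exact (amalgam_act_pure T' (@lift_coact_linear M) a b v). Qed.

Definition to_lift M : mhom (F (res T M)) (res T' (lift_obj M)) :=
  to_amalgam T' (@lift_coact_linear M) (@lift_coact1 M) (@lift_coactM M).

Lemma to_lift_miso M : miso (to_lift M).
Proof. exact: to_amalgam_miso. Qed.

Lemma to_liftE M v : mfun (to_lift M) v = v.
Proof. exact: to_amalgamE. Qed.

Lemma to_lift_coact M b :
  mcomp (to_lift M) (fmap F _ _ (coact T M b)) =
  mcomp (coact T' (lift_obj M) b) (to_lift M).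
Proof. exact: to_amalgam_coact. Qed.

Lemma lift_fmap_subproof M N (f : mhom M N) e (v : lift_obj M) :
  (mfun (fmap F _ _ (res_map T f)) : 'Hom(lift_obj M, lift_obj N)) (act e v) =
  act e ((mfun (fmap F _ _ (res_map T f)) : 'Hom(lift_obj M, lift_obj N)) v).
Proof.
set g := fmap F _ _ _.
have ll := act_linearl.
apply: (tpure_ext (t := T') (f := fun e => (mfun g : 'Hom(lift_obj M, lift_obj N)) (act e v))
  (g := fun e => act (f := lift_obj N) e (mfun g v))) => [c x y|c x y|a b].
- by rewrite ll linearP.
- exact: ll.
cbv beta; rewrite !lift_act_pure.
rewrite [LHS](mfun_act g a (mfun (lift_coact M b) v)) -[in LHS]mcompE.
by rewrite -[in RHS]mcompE /lift_coact /g -!fmap_comp res_map_coact.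
Qed.

Definition lift_fmap M N (f : mhom M N) : mhom (lift_obj M) (lift_obj N) :=
  mkhom (lift_fmap_subproof f).

Lemma to_lift_fmap M N (f : mhom M N) :
  mcomp (to_lift N) (fmap F _ _ (res_map T f)) =
  mcomp (res_map T' (lift_fmap f)) (to_lift M).
Proof. by apply: mhom_ext => v; rewrite !mcompE !to_liftE. Qed.

Lemma lift_fmap_linear M N : linear (@lift_fmap M N).
Proof.
move=> c f g; apply: mhom_ext => v.
have e : fmap F _ _ (res_map T (c *: f + g)) =
    c *: fmap F _ _ (res_map T f) + fmap F _ _ (res_map T g).
  have e := res_map_linear T c f g.
  rewrite e.
  exact: linearP.
have e' : mfun (fmap F _ _ (res_map T (c *: f + g))) v =
    c *: mfun (fmap F _ _ (res_map T f)) v + mfun (fmap F _ _ (res_map T g)) v.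
  by rewrite e mfun_lin.
exact (etrans e' (esym (mfun_lin c (lift_fmap f) (lift_fmap g) v))).
Qed.

Definition lift_map M N : {linear mhom M N -> mhom (lift_obj M) (lift_obj N)} :=
  HB.pack (@lift_fmap M N)
    (GRing.isSemilinear.Build k _ _ _ (@lift_fmap M N)
      (GRing.semilinear_linear (@lift_fmap_linear M N))).

Lemma lift_map_id M : lift_map M M (mid M) = mid (lift_obj M).
Proof.
have e : fmap F _ _ (res_map T (mid M)) = mid (F (res T M)).
  by rewrite res_map_id fmap_id.
apply: mhom_ext => v; rewrite [RHS]midE.
have e' : mfun (fmap F _ _ (res_map T (mid M))) v = v by rewrite e midE.
exact e'.
Qed.

Lemma lift_map_comp M N P (g : mhom N P) (f : mhom M N) :
  lift_map M P (mcomp g f) = mcomp (lift_map N P g) (lift_map M N f).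
Proof.
have e : fmap F _ _ (res_map T (mcomp g f)) =
    mcomp (fmap F _ _ (res_map T g)) (fmap F _ _ (res_map T f)).
  by rewrite res_map_comp fmap_comp.
apply: mhom_ext => v; rewrite [RHS]mcompE.
have e' : mfun (fmap F _ _ (res_map T (mcomp g f))) v =
    mfun (fmap F _ _ (res_map T g)) (mfun (fmap F _ _ (res_map T f)) v).
  by rewrite e mcompE.
exact e'.
Qed.

Definition lift_functor : kfunctor E E' := KFunctor lift_map_id lift_map_comp.

End Lift.

(** Naturality of M -> G (F M) with respect to the endomorphisms by which B acts
    makes this map B-linear. *)
Lemma lift_natiso (k : fieldType) (A A' B E E' : falgType k)
  (T : tensor_structure A B E) (T' : tensor_structure A' B E')
  (F : kfunctor A A') (G : kfunctor A' A) :
  natiso_id F G -> natiso_id (lift_functor T T' F) (lift_functor T' T G).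
Proof.
move=> [eta [etai etan]].
pose e M := mcomp (to_lift T' T G (lift_functor T T' F M))
  (mcomp (fmap G _ _ (to_lift T T' F M)) (eta (res T M))).
have eB M b : mcomp (e M) (coact T M b) =
    mcomp (coact T (lift_functor T' T G (lift_functor T T' F M)) b) (e M).
  rewrite /e [RHS]mcompA -to_lift_coact -!mcompA; congr mcomp.
  by rewrite etan !mcompA -!fmap_comp; congr (mcomp (fmap G _ _ _) _); exact: to_lift_coact.
pose h M := projT1 (cid (biaction_hom (eB M))).
have hE M : res_map T (h M) = e M by rewrite /h; case: cid.
exists h; split=> [M|M N f].
  apply: (res_map_miso (T := T)); rewrite hE.
  apply: miso_comp; first exact: to_lift_miso.
  by apply: miso_comp (etai _); apply: fmap_miso; exact: to_lift_miso.
apply: (res_map_inj (T := T)); rewrite !res_map_comp !hE /e.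
rewrite -!mcompA etan [RHS]mcompA -to_lift_fmap -!mcompA; congr mcomp.
by rewrite !mcompA -!fmap_comp; congr (mcomp (fmap G _ _ _) _); exact: to_lift_fmap.
Qed.

Lemma lift_equivalence (k : fieldType) (A A' B E E' : falgType k)
  (T : tensor_structure A B E) (T' : tensor_structure A' B E')
  (F : kfunctor A A') (G : kfunctor A' A) :
  equivalence F G -> equivalence (lift_functor T T' F) (lift_functor T' T G).
Proof. by case=> FG GF; split; exact: lift_natiso. Qed.

(** * The perfect pairing between F (D A) and G (A') *)

Section Representing.

Variables (k : fieldType) (A : falgType k).
Implicit Types J R N : fdmod A.

(** u generates R freely: R is isomorphic to A, with u corresponding to 1. *)
Definition free_generator R (u : R) : Prop :=
  (forall a, act a u = 0 -> a = 0) /\ (forall r, exists a, act a u = r).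

(** The pairing t (a j) between A and J is perfect: J is isomorphic to D A, with t
    corresponding to the evaluation at 1. *)
Definition dual_generator J (t : 'Hom(J, k^o)) : Prop :=
  (forall j, (forall a, t (act a j) = 0) -> j = 0) /\
  (forall psi : 'Hom(A, k^o), exists j, forall a, t (act a j) = psi a).

Lemma free_generator_inj R (u : R) N (f g : mhom R N) : free_generator u ->
  mfun f u = mfun g u -> f = g.
Proof.
move=> [_ us] e; apply: mhom_ext => r; have [a <-] := us r.
by rewrite !mfun_act e.
Qed.

(** The map sends a u to a n, which is well defined because u is free. *)
Lemma free_generator_ex R (u : R) N (n : N) : free_generator u ->
  exists f : mhom R N, mfun f u = n.
Proof.
move=> [ui us].
have al : linear (fun a : A => act a u) by exact: act_linearl.
have ai a b : act a u = act b u -> a = b.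
  move=> e; apply/eqP; rewrite -subr_eq0; apply/eqP/ui.
  by rewrite -(lin_mapE al) linearB /= !lin_mapE e subrr.
pose c r := projT1 (cid (us r)).
have cE r : act (c r) u = r by rewrite /c; case: cid.
have fl : linear (fun r => act (c r) n).
  move=> x r s; rewrite -act_linearl; congr act; apply: ai.
  by rewrite act_linearl !cE.
have fM a r : lin_map fl (act a r) = act a (lin_map fl r).
  by rewrite !lin_mapE -actM; congr act; apply: ai; rewrite actM !cE.
exists (mkhom fM); rewrite mkhomE lin_mapE.
have -> : c u = 1 by apply: ai; rewrite cE act1.
exact: act1.
Qed.

Lemma dual_generator_inj J (t : 'Hom(J, k^o)) N (f : mhom N J) :
  dual_generator t -> (forall x, t (mfun f x) = 0) -> f = 0.
Proof.
move=> [tinj _] tf; apply: mhom_ext => x; rewrite mfun0.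
by apply: tinj => a; rewrite -mfun_act.
Qed.

(** The map sends x to the element of J that represents the functional
    a |-> phi (a x) on A. *)
Lemma dual_generator_ex J (t : 'Hom(J, k^o)) N (phi : 'Hom(N, k^o)) :
  dual_generator t -> exists f : mhom N J, forall x, t (mfun f x) = phi x.
Proof.
move=> [tinj tsurj].
have orbl x : linear (fun a : A => phi (act a x)).
  by move=> c a b; rewrite act_linearl linearP.
pose c x := projT1 (cid (tsurj (lin_map (orbl x)))).
have cE x a : t (act a (c x)) = phi (act a x).
  by rewrite /c; case: cid => j /= ->; rewrite lin_mapE.
have inj i j : (forall a, t (act a i) = t (act a j)) -> i = j.
  move=> e; apply/eqP; rewrite -subr_eq0; apply/eqP/tinj => a.
  by rewrite !linearB /= e subrr.
have fl : linear c.
  move=> b x y; apply: inj => a; rewrite cE !linearP /=.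
  by rewrite -!cE.
have fM a x : lin_map fl (act a x) = act a (lin_map fl x).
  by rewrite !lin_mapE; apply: inj => b; rewrite cE -!actM cE.
exists (mkhom fM) => x; rewrite mkhomE lin_mapE.
by rewrite -[c x]act1 cE act1.
Qed.

End Representing.

Section Pairing.

Variables (k : fieldType) (A A' : falgType k).
Variables (F : kfunctor A A') (G : kfunctor A' A).
Hypothesis FG : equivalence F G.
Variables (J : fdmod A) (t : 'Hom(J, k^o)) (R : fdmod A') (u : R).
Hypotheses (tJ : dual_generator t) (uR : free_generator u).

(** The pairing is the composite of the bijections
      F J = Hom(R, F J) = Hom(G R, G F J) = Hom(G R, J) = D (G R).
    The last two clauses express that it is compatible with endomorphisms r of
    R and psi of J: on either side the action of an algebra element corresponds
    to the image, under the functor, of the endomorphism that multiplies the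
    generator by this element. *)
Lemma perfect_pairing : exists b : 'Hom(F J, 'Hom(G R, k^o)),
  [/\ injective b, (forall phi, exists y, b y = phi),
     forall a (r : mhom R R) y q, mfun r u = act a u ->
       b (act a y) q = b y (mfun (fmap G _ _ r) q) &
     forall a (psi : mhom J J) y q, (forall j, t (mfun psi j) = t (act a j)) ->
       b (mfun (fmap F _ _ psi) y) q = b y (act a q)].
Proof.
have [th [thi thn]] := natiso_inverse FG.1.
have [th' [th'K thK']] := thi J.
(* hat y : R -> F J sends the generator u to y. *)
pose hat (y : F J) : mhom R (F J) := projT1 (cid (free_generator_ex y uR)).
have hatE y : mfun (hat y) u = y by rewrite /hat; case: cid.
have hatP y h : mfun h u = y -> hat y = h.
  by move=> hu; apply: (free_generator_inj uR); rewrite hatE.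
pose g y := mcomp (th J) (fmap G _ _ (hat y)).
have gl y : linear (fun q => t (mfun (g y) q)) by move=> c p q; rewrite !linearP.
have bl : linear (fun y => lin_map (gl y)).
  move=> c x y; apply/lfunP => q; rewrite add_lfunE scale_lfunE !lin_mapE.
  have e : hat (c *: x + y) = c *: hat x + hat y.
    by apply: hatP; rewrite mfun_lin !hatE.
  have -> : g (c *: x + y) = c *: g x + g y.
    by rewrite /g e linearP mcomp_linearr.
  by rewrite mfun_lin linearP.
have bE y q : lin_map bl y q = t (mfun (th J) (mfun (fmap G _ _ (hat y)) q)).
  by rewrite !lin_mapE /g mcompE.
exists (lin_map bl); split.
- apply/lker0P/eqP/vspaceP => y; rewrite memv0 memv_ker.
  apply/eqP/eqP => [y0|->]; last by rewrite linear0.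
  have g0 : g y = 0.
    apply: (dual_generator_inj tJ) => q.
    by rewrite mcompE -bE y0 zero_lfunE.
  rewrite -(hatE y) (natiso_faithful FG.2 (f := hat y)) ?mfun0 //.
  by rewrite -[LHS]mcomp1f -th'K -mcompA -/(g y) g0 mcomp0.
- move=> phi; have [f fE] := dual_generator_ex phi tJ.
  have [h hE] := equiv_full (equivalence_sym FG) (mcomp th' f).
  exists (mfun h u); apply/lfunP => q.
  rewrite bE (hatP _ h) // hE -mcompE mcompA thK' mcomp1f; exact: fE.
- move=> a r y q ra; rewrite !bE; have -> : hat (act a y) = mcomp (hat y) r.
    by apply: hatP; rewrite mcompE ra mfun_act hatE.
  by rewrite fmap_comp mcompE.
- move=> a psi y q psia; rewrite !bE.
  have -> : hat (mfun (fmap F _ _ psi) y) = mcomp (fmap F _ _ psi) (hat y).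
    by apply: hatP; rewrite mcompE hatE.
  by rewrite fmap_comp mcompE -mcompE -thn mcompE psia !mfun_act.
Qed.

End Pairing.

(** In finite dimension a pairing that is perfect on one side is perfect on the
    other. *)
Section DualPairing.

Variables (k : fieldType) (U V : vectType k) (b : 'Hom(U, 'Hom(V, k^o))).
Hypotheses (bi : injective b) (bs : forall phi, exists x, b x = phi).

Lemma flip_pairing_linear v : linear (fun x => b x v : k^o).
Proof. by move=> c x y; rewrite linearP add_lfunE scale_lfunE. Qed.

Lemma flip_pairing_linear2 : linear (fun v => lin_map (flip_pairing_linear v)).
Proof.
by move=> c v w; apply/lfunP => x; rewrite add_lfunE scale_lfunE !lin_mapE linearP.
Qed.

Definition flip_pairing : 'Hom(V, 'Hom(U, k^o)) := lin_map flip_pairing_linear2.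

Lemma flip_pairingE v x : flip_pairing v x = b x v.
Proof. by rewrite !lin_mapE. Qed.

Lemma flip_pairing_inj : injective flip_pairing.
Proof.
apply/lker0P/eqP/vspaceP => v; rewrite memv0 memv_ker.
apply/eqP/eqP => [v0|->]; last by rewrite linear0.
apply: functional_ext => phi; have [x <-] := bs phi.
by rewrite -flip_pairingE v0 zero_lfunE.
Qed.

Lemma flip_pairing_surj phi : exists v, flip_pairing v = phi.
Proof.
apply: inj_surj flip_pairing_inj _ phi.
by rewrite dim_dual -(dim_dual V) -(dim_inj_surj bi bs).
Qed.

End DualPairing.

(** * Comparison of the two induced functors on bimodules *)

Section LiftIso.

Variables (k : fieldType) (L L' : falgType k).
Variables (F : kfunctor L L') (G : kfunctor L' L).
Variables (X : bimod L) (X' : bimod L').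

Definition lift_left : kfunctor (tensor L L^c) (tensor L' L^c) :=
  lift_functor (tensor_tensor L L^c) (tensor_tensor L' L^c) F.

Definition lift_right : kfunctor (tensor L' L'^c) (tensor L' L^c) :=
  lift_functor (tensor_flip (tensor_tensor L' L'^c)) (tensor_flip (tensor_tensor L' L^c))
    (converse_functor G).

Definition left_mod : fdmod L := res (tensor_tensor L L^c) X.
Definition right_mod : fdmod L'^c := res (tensor_flip (tensor_tensor L' L'^c)) X'.

Definition right_coact (b : L^c) : mhom left_mod left_mod :=
  coact (tensor_tensor L L^c) X b.
Definition left_coact (a : L') : mhom right_mod right_mod :=
  coact (tensor_flip (tensor_tensor L' L'^c)) X' a.

Lemma lift_left_act a b (y : F left_mod) :
  act (f := lift_left X) (pure a b) y = act a (mfun (fmap F _ _ (right_coact b)) y).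
Proof. exact: (lift_act_pure (T := tensor_tensor L L^c) (tensor_tensor L' L^c) (F := F) a b y). Qed.

Lemma lift_right_act a b (y : 'Hom(G (dual_right right_mod), k^o)) q :
  (act (f := lift_right X') (pure a b) y : 'Hom(G (dual_right right_mod), k^o)) q =
  y (mfun (fmap G _ _ (dual_right_map (left_coact a))) (act (b : L) q)).
Proof.
have e := lift_act_pure (T := tensor_flip (tensor_tensor L' L'^c))
  (tensor_flip (tensor_tensor L' L^c)) (F := converse_functor G)
  (M := X') b a y.
rewrite [act _ _]e [LHS]dual_actE.
exact: dual_mapE.
Qed.

(** The underlying spaces are F X and D (G (D X')), so that an isomorphism is a
    perfect pairing of F X with G (D X'). Its two conditions are linearity over
    L' and over the converse of L. *)
Lemma pairing_lift_isomorphic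
    (h : 'Hom(F left_mod, 'Hom(G (dual_right right_mod), k^o))) :
  injective h -> (forall phi, exists y, h y = phi) ->
  (forall (a : L') y q, h (act a y) q =
     h y (mfun (fmap G _ _ (dual_right_map (left_coact a))) q)) ->
  (forall (b : L^c) y q, h (mfun (fmap F _ _ (right_coact b)) y) q =
     h y (act (b : L) q)) ->
  isomorphic (lift_left X) (lift_right X').
Proof.
move=> hi hs ha hb.
have hM e (y : lift_left X) : (h : 'Hom(lift_left X, lift_right X')) (act e y) =
    act (f := lift_right X') e (h y).
  apply: (tensor_ext (f := fun e => (h : 'Hom(lift_left X, lift_right X')) (act e y))
    (g := fun e => act (f := lift_right X') e (h y))) => [c u v|c u v|a b].
  - by rewrite act_linearl linearP.
  - exact: act_linearl.
  cbv beta; rewrite [X in h X = _]lift_left_act.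
  apply/lfunP => q; rewrite [RHS]lift_right_act [LHS]ha hb.
  by rewrite mfun_act.
exists (mkhom hM); apply: miso_bij; first exact: hi.
exact: hs.
Qed.

End LiftIso.

Section RegularBimodule.

Variables (k : fieldType) (A : falgType k).

Lemma dualbim_act_pure (a : A) (b : A^c) (phi : 'Hom(A, k^o)) x :
  (act (f := dualbim (regbim A)) (pure a b) phi : 'Hom(A, k^o)) x =
  phi ((b : A) * x * a).
Proof.
have e := @dual_actE k _ _ (@swap k A) (regbim A) (pure a b) phi x.
rewrite [LHS]e [X in act X]swap_pure; congr (phi _); exact: regbim_act_pure.
Qed.

Lemma left_regbim_act a (x : left_mod (regbim A)) : act a x = a * x :> A.
Proof. by rewrite res_actE [LHS]regbim_act_pure mulr1. Qed.

Lemma right_coact_regbim b (x : left_mod (regbim A)) :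
  mfun (right_coact (regbim A) b) x = x * (b : A) :> A.
Proof. by rewrite coactE [LHS]regbim_act_pure mul1r. Qed.

Lemma right_regbim_act b (x : right_mod (regbim A)) : act b x = x * (b : A) :> A.
Proof. by rewrite res_actE [LHS]regbim_act_pure mul1r. Qed.

Lemma left_coact_regbim a (x : right_mod (regbim A)) :
  mfun (left_coact (regbim A) a) x = a * x :> A.
Proof. by rewrite coactE [LHS]regbim_act_pure mulr1. Qed.

Lemma left_dualbim_act a (phi : left_mod (dualbim (regbim A))) x :
  (act a phi : 'Hom(A, k^o)) x = (phi : 'Hom(A, k^o)) (x * a).
Proof. by rewrite res_actE [LHS]dualbim_act_pure mul1r. Qed.

Lemma right_coact_dualbim b (phi : left_mod (dualbim (regbim A))) x :
  (mfun (right_coact (dualbim (regbim A)) b) phi : 'Hom(A, k^o)) x =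
  (phi : 'Hom(A, k^o)) ((b : A) * x).
Proof. by rewrite coactE [LHS]dualbim_act_pure mulr1. Qed.

Lemma right_dualbim_act b (phi : right_mod (dualbim (regbim A))) x :
  (act b phi : 'Hom(A, k^o)) x = (phi : 'Hom(A, k^o)) ((b : A) * x).
Proof. by rewrite res_actE [LHS]dualbim_act_pure mulr1. Qed.

Lemma left_coact_dualbim a (phi : right_mod (dualbim (regbim A))) x :
  (mfun (left_coact (dualbim (regbim A)) a) phi : 'Hom(A, k^o)) x =
  (phi : 'Hom(A, k^o)) (x * a).
Proof. by rewrite coactE [LHS]dualbim_act_pure mul1r. Qed.

Lemma dual_right_actE (M : fdmod A^c) (a : A) (phi : 'Hom(M, k^o)) v :
  (act (f := dual_right M) a phi : 'Hom(M, k^o)) v = phi (act (a : A^c) v).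
Proof. exact: dual_actE. Qed.

Lemma dual_right_regbim_act a (phi : dual_right (right_mod (regbim A))) (x : A) :
  (act a phi : 'Hom(A, k^o)) x = (phi : 'Hom(A, k^o)) (x * a).
Proof.
rewrite -[x * a](right_regbim_act (a : A^c) x).
exact (@dual_right_actE (right_mod (regbim A)) a phi x).
Qed.

Lemma left_regbim_generator :
  free_generator (R := left_mod (regbim A)) (1 : A).
Proof.
split=> [a|r]; first by rewrite left_regbim_act mulr1.
by exists (r : A); rewrite left_regbim_act mulr1.
Qed.

Lemma left_dualbim_generator :
  dual_generator (J := left_mod (dualbim (regbim A))) (eval_at (1 : A)).
Proof.
split=> [phi phi0|psi].
  apply/lfunP => a; rewrite zero_lfunE -(phi0 a) eval_atE.
  by rewrite [RHS]left_dualbim_act mul1r.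
exists psi => a; rewrite eval_atE.
by rewrite [LHS]left_dualbim_act mul1r.
Qed.

Lemma dual_right_regbim_generator :
  dual_generator (J := dual_right (right_mod (regbim A))) (eval_at (1 : A)).
Proof.
have E a (phi : dual_right (right_mod (regbim A))) :
    eval_at (1 : A) (act a phi) = (phi : 'Hom(A, k^o)) a.
  by rewrite eval_atE [LHS]dual_right_regbim_act mul1r.
split=> [phi phi0|psi].
  by apply/lfunP => a; rewrite zero_lfunE -(phi0 a) E.
by exists psi => a; rewrite E.
Qed.

(** The bidual of A is generated by the evaluation at 1, since a times the
    evaluation at 1 is the evaluation at a, and A is reflexive. *)
Lemma dual_right_dualbim_generator :
  free_generator (R := dual_right (right_mod (dualbim (regbim A))))
    (eval_at (1 : A)).
Proof.
have E a : act (f := dual_right (right_mod (dualbim (regbim A)))) a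
    (eval_at (1 : A)) = eval_at a.
  apply/lfunP => phi; rewrite [LHS]dual_right_actE !eval_atE.
  by rewrite [LHS]right_dualbim_act mulr1.
split=> [a|xi].
  rewrite E => a0; apply: functional_ext => phi.
  by rewrite -eval_atE a0 zero_lfunE.
have ei : injective (lin_map (@eval_at_linear k A)).
  apply/lker0P/eqP/vspaceP => v; rewrite memv0 memv_ker lin_mapE.
  apply/eqP/eqP => [v0|->].
    by apply: functional_ext => phi; rewrite -eval_atE v0 zero_lfunE.
  by apply/lfunP => phi; rewrite eval_atE linear0 zero_lfunE.
have [|a aE] := inj_surj ei _ xi; first by rewrite !dim_dual.
by exists a; rewrite E -aE lin_mapE.
Qed.

End RegularBimodule.

(** * Invariance *)

Section Images.

Variables (k : fieldType) (L L' : falgType k).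
Variables (F : kfunctor L L') (G : kfunctor L' L).
Hypothesis FG : equivalence F G.

Lemma lift_dualbim :
  isomorphic (lift_left F (dualbim (regbim L))) (lift_right G (dualbim (regbim L'))).
Proof.
have [h [hi hs ha hb]] := perfect_pairing FG (@left_dualbim_generator k L)
  (@dual_right_dualbim_generator k L').
apply: (pairing_lift_isomorphic (h := h)) => // [a y q|b y q].
  apply: ha; apply/lfunP => phi.
  rewrite dual_mapE [RHS]dual_right_actE !eval_atE.
  by rewrite [LHS]left_coact_dualbim [RHS]right_dualbim_act mul1r mulr1.
apply: hb => phi; rewrite !eval_atE.
by rewrite [LHS]right_coact_dualbim [RHS]left_dualbim_act mul1r mulr1.
Qed.

(** Here L is the free module and D L' the dual one, so the pairing is taken for
    G and F in exchanged roles and read from the other side. *)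
Lemma lift_regbim :
  isomorphic (lift_left F (regbim L)) (lift_right G (regbim L')).
Proof.
have [h [hi hs ha hb]] := perfect_pairing (equivalence_sym FG)
  (@dual_right_regbim_generator k L') (@left_regbim_generator k L).
apply: (pairing_lift_isomorphic (h := flip_pairing h)) => [||a y q|b y q].
- exact: flip_pairing_inj.
- exact: flip_pairing_surj.
- rewrite !flip_pairingE; symmetry; apply: hb => phi; rewrite !eval_atE.
  rewrite [LHS]dual_mapE left_coact_regbim mulr1.
  by rewrite [RHS]dual_right_regbim_act mul1r.
rewrite !flip_pairingE; symmetry; apply: ha.
by rewrite right_coact_regbim left_regbim_act mul1r mulr1.
Qed.

End Images.

(** Both bimodule categories are equivalent to that of L'-L-bimodules, where the
    images of L and L' coincide by lift_regbim. *)
Lemma morita_dim_hom_tau_n (k : fieldType) (L L' : falgType k) n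
  (X : bimod L) (X' : bimod L') (F : kfunctor L L') (G : kfunctor L' L) :
  equivalence F G -> isomorphic (lift_left F X) (lift_right G X') ->
  dim (mhom X (tau_n n (regbim L))) = dim (mhom X' (tau_n n (regbim L'))).
Proof.
move=> FG FX.
have eqF := lift_equivalence (tensor_tensor L L^c) (tensor_tensor L' L^c) FG.
have eqG := lift_equivalence (tensor_flip (tensor_tensor L' L'^c))
  (tensor_flip (tensor_tensor L' L^c)) (converse_equivalence (equivalence_sym FG)).
rewrite (equiv_dim_hom_tau_n eqF n (lift_regbim FG) FX).
symmetry; apply: (equiv_dim_hom_tau_n eqG n); exists (mid _); exact: miso_id.
Qed.

Theorem corollary2p19 (k : fieldType) (L L' : falgType k)
  (sepL : separable_mod_radical L) (sepL' : separable_mod_radical L')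
  (morita : Morita_equivalent L L') (n : nat) (n_ge1 : (1 <= n)%N) :
  vsp_iso (HHtau_cohomology n (regbim L)) (HHtau_cohomology n (regbim L')) /\
  vsp_iso (HHtau_homology n (regbim L)) (HHtau_homology n (regbim L')).
Proof.
have [F [G FG]] := morita; split; apply: vsp_iso_dim.
  rewrite !dim_dual; exact: (morita_dim_hom_tau_n n FG (lift_regbim FG)).
exact: (morita_dim_hom_tau_n n FG (lift_dualbim FG)).
Qed.
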